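(* Let $\check Y\in\mathbb{R}^{n\times m}$ be a point satisfying the GLICQ condition for the QCQP and such that $$s(\check Y)>2(\rho_1+\rho_2)\,d_{\mathcal{F}}(\check Y).$$ Suppose that $$\eta>\|A_0\|_1+\|A_0\|_2+\frac{2\rho_1\|A_0\|_1\,d_{\mathcal{F}}(\check Y)+2(2\rho_1+\rho_2)\big(\|\nabla q_0(\check Y)\|_F+\|A_0\|_2\,d_{\mathcal{F}}(\check Y)\big)}{s(\check Y)-2(\rho_1+\rho_2)\,d_{\mathcal{F}}(\check Y)}$$ and that, for every $k\in\mathcal{I}\setminus\mathcal{B}_{\check Y}$, $$\eta>\|A_0\|_2+\big(\|\nabla q_0(\check Y)\|_F+\|A_0\|_2\,d_{\mathcal{F}}(\check Y)\big)\left(\sqrt{\frac{\|A_k\|_2}{|\tilde q_k(\check Y)|}}+\frac{\|\nabla q_k(\check Y)\|_F+2\|A_k\|_2\,d_{\mathcal{F}}(\check Y)}{|\tilde q_k(\check Y)|}\right),$$ where $\mathcal{B}_{\check Y}$ is the set of quasi-binding constraints for $\check Y$. Then the penalized parabolic relaxation with initial point $\check Y$ and penalty $\eta$ has a unique optimal solution $(Y^*,X^* )$, and it satisfies $X^*=Y^*(Y^* )^\top$ and $q_0(Y^* )\le\tilde q_0(\check Y)$.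
   Context: Norms: $\|\cdot\|_F$ is the Frobenius norm; for matrices $\|\cdot\|_1,\|\cdot\|_2$ are the induced (operator) 1- and 2-norms. QCQP: let $\mathcal{E},\mathcal{I}$ be finite disjoint index sets (equalities and inequalities), not containing $0$. For $k\in\{0\}\cup\mathcal{E}\cup\mathcal{I}$ let $A_k$ be a real symmetric $n\times n$ matrix, $B_k\in\mathbb{R}^{n\times m}$, $c_k\in\mathbb{R}$, and $q_k(Y)=\mathrm{tr}\{Y^\top A_kY\}+2\,\mathrm{tr}\{B_k^\top Y\}+c_k$ for $Y\in\mathbb{R}^{n\times m}$ (so $\nabla q_k(Y)=2(A_kY+B_k)$). The QCQP is: minimize $q_0(Y)$ over $Y\in\mathbb{R}^{n\times m}$ subject to $q_k(Y)=0$ ($k\in\mathcal{E}$) and $q_k(Y)\le0$ ($k\in\mathcal{I}$). Its feasible set is $\mathcal{F}$ (nonempty, so that the distance below is defined). Penalized parabolic relaxation with initial point $\check Y\in\mathbb{R}^{n\times m}$ and penalty $\eta>0$: with $\bar q_k(Y,X)=\mathrm{tr}\{A_kX\}+2\,\mathrm{tr}\{B_k^\top Y\}+c_k$ and $e_i$ the standard basis of $\mathbb{R}^n$, minimize $\bar q_0(Y,X)+\eta\,\mathrm{tr}\{X-2\check YY^\top+\check Y\check Y^\top\}$ over $Y\in\mathbb{R}^{n\times m}$ and real symmetric $n\times n$ matrices $X$, subject to $\bar q_k(Y,X)=0$ ($k\in\mathcal{E}$), $\bar q_k(Y,X)\le0$ ($k\in\mathcal{I}$), and for all $i,j\in\{1,\dots,n\}$: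 $X_{ii}+X_{jj}-2X_{ij}\ge\|(e_i-e_j)^\top Y\|_2^2$ and $X_{ii}+X_{jj}+2X_{ij}\ge\|(e_i+e_j)^\top Y\|_2^2$. Feasibility distance: $d_{\mathcal{F}}(\check Y)=\min\{\|Y-\check Y\|_F: Y\in\mathcal{F}\}$. Quasi-binding constraints: $\tilde q_k(\check Y)=q_k(\check Y)+\|\nabla q_k(\check Y)\|_F\,d_{\mathcal{F}}(\check Y)+\|A_k\|_2\,d_{\mathcal{F}}(\check Y)^2$ for $k\in\{0\}\cup\mathcal{E}\cup\mathcal{I}$, and $\mathcal{B}_{\check Y}=\mathcal{E}\cup\{k\in\mathcal{I}:\tilde q_k(\check Y)\ge0\}$. GLICQ and singularity function: for $\mathcal{Q}\subseteq\mathcal{E}\cup\mathcal{I}$, the Jacobian $J_{\mathcal{Q}}(Y)\in\mathbb{R}^{|\mathcal{Q}|\times nm}$ has rows $\mathrm{vec}\{\nabla q_k(Y)\}^\top$, $k\in\mathcal{Q}$. A point $Y\in\mathbb{R}^{n\times m}$ satisfies GLICQ if the rows of $J_{\mathcal{B}_Y}(Y)$ are linearly independent. $s(Y)$ is the smallest singular value $\sigma_{\min}(J_{\mathcal{B}_Y}(Y))$ if $|\mathcal{B}_Y|\le nm$, and $s(Y)=0$ otherwise; if $\mathcal{B}_Y=\emptyset$, $s(Y)=+\infty$ (so a quotient with $s(Y)$ minus a finite number in the denominator is $0$). Pencil norms: for $\ell\in\{1,2\}$, $\rho_\ell=\max\{\|\sum_{k\in\mathcal{E}\cup\mathcal{I}}\tau_kA_k\|_\ell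 : \tau\in\mathbb{R}^{|\mathcal{E}\cup\mathcal{I}|},\ \|\tau\|_2=1\}$. *)

(* Defs.v *)
From HB Require Import structures.
From mathcomp Require Import all_boot all_order all_algebra.
From mathcomp Require Import all_classical all_reals.

Set Implicit Arguments.
Unset Strict Implicit.
Unset Printing Implicit Defensive.

Import Order.TTheory GRing.Theory Num.Theory.

Local Open Scope classical_set_scope.
Local Open Scope ring_scope.

(* On row and column vectors this is the Euclidean norm. *)
Definition frobenius {R : realType} {p q : nat} (M : 'M[R]_(p, q)) : R :=
  Num.sqrt (\sum_i \sum_j M i j ^+ 2).

Definition vnorm1 {R : realType} {p : nat} (x : 'cV[R]_p) : R :=
  \sum_i `|x i 0|.

Definition vnorm2 {R : realType} {p : nat} (x : 'cV[R]_p) : R := frobenius x.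

(* The operator norm induced by N; the unit ball is never empty, so that this
   is 0 when p = 0. *)
Definition opnorm {R : realType} {p : nat} (N : 'cV[R]_p -> R) (M : 'M[R]_p) : R :=
  sup [set N (M *m x) | x in [set x | N x <= 1]].

Definition opnorm1 {R : realType} {p : nat} : 'M[R]_p -> R := opnorm vnorm1.

Definition opnorm2 {R : realType} {p : nat} : 'M[R]_p -> R := opnorm vnorm2.

(* The singular values of a matrix with at most as many rows as columns; for
   other shapes the Gram matrix would be the other one, M^T *m M. *)
Definition wide_singular_values {R : realType} {p q : nat} (M : 'M[R]_(p, q)) :
    set R :=
  [set Num.sqrt a | a in [set a | eigenvalue (M *m M^T) a]].

(* Only meaningful for 0 < p <= q; the set is then finite and nonempty. *)
Definition sigma_min {R : realType} {p q : nat} (M : 'M[R]_(p, q)) : R :=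
  inf (wide_singular_values M).

Record quadratic (R : realType) (n m : nat) := Quadratic {
  qA : 'M[R]_n;
  qB : 'M[R]_(n, m);
  qc : R;
  qA_sym : qA^T = qA
}.

Section Quadratic.
Context {R : realType} {n m : nat}.
Implicit Types (q : quadratic R n m) (Y : 'M[R]_(n, m)) (X : 'M[R]_n).

Definition qval q Y : R :=
  \tr (Y^T *m qA q *m Y) + 2 * \tr ((qB q)^T *m Y) + qc q.

Definition qgrad q Y : 'M[R]_(n, m) := 2 *: (qA q *m Y + qB q).

Definition qlift q Y X : R :=
  \tr (qA q *m X) + 2 * \tr ((qB q)^T *m Y) + qc q.

End Quadratic.

(* E indexes the equality constraints and I the inequality constraints; the
   disjoint union of the index sets is the sum type E + I. *)
Record qcqp (R : realType) (n m : nat) (E I : finType) := QCQP {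
  obj : quadratic R n m;
  con : E + I -> quadratic R n m
}.

Section QCQP.
Context {R : realType} {n m : nat} {E I : finType}.
Implicit Types (P : qcqp R n m E I) (Y : 'M[R]_(n, m)) (X : 'M[R]_n).

Definition feasible P : set 'M[R]_(n, m) :=
  [set Y | (forall k : E, qval (con P (inl k)) Y = 0) /\
           (forall k : I, qval (con P (inr k)) Y <= 0)].

(* When feasible P is nonempty the infimum is attained, since that set is
   closed. *)
Definition dist P Y : R := inf [set frobenius (Z - Y) | Z in feasible P].

Definition qtilde P (q : quadratic R n m) Y : R :=
  qval q Y + frobenius (qgrad q Y) * dist P Y + opnorm2 (qA q) * dist P Y ^+ 2.

Definition quasi_binding P Y : {set E + I} :=
  [set k | match k with
           | inl _ => true
           | inr _ => 0 <= qtilde P (con P k) Y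
           end].

(* mxvec stacks rows rather than columns, which only permutes the columns of
   the Jacobian. *)
Definition jacobian P (Q : {set E + I}) Y : 'M[R]_(#|Q|, n * m) :=
  \matrix_(i < #|Q|) mxvec (qgrad (con P (enum_val i)) Y).

Definition glicq P Y : Prop := row_free (jacobian P (quasi_binding P Y) Y).

Definition sfun P Y : \bar R :=
  let B := quasi_binding P Y in
  if B == finset.set0 then +oo%E
  else if (#|B| <= n * m)%N then (sigma_min (jacobian P B Y))%:E
  else 0%E.

Definition pencil P (tau : E + I -> R) : 'M[R]_n :=
  \sum_(k : E + I) tau k *: qA (con P k).

(* When E + I is empty there is no unit tau, and this is sup set0 = 0. *)
Definition pencil_norm P (N : 'M[R]_n -> R) : R :=
  sup [set N (pencil P tau) |
       tau in [set tau : E + I -> R | Num.sqrt (\sum_k tau k ^+ 2) = 1]].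

Definition rho1 P : R := pencil_norm P opnorm1.

Definition rho2 P : R := pencil_norm P opnorm2.

Definition std_row (i : 'I_n) : 'rV[R]_n := delta_mx 0 i.

Definition parabolic_feasible P Y X : Prop :=
  [/\ X^T = X,
      forall k : E, qlift (con P (inl k)) Y X = 0,
      forall k : I, qlift (con P (inr k)) Y X <= 0,
      forall i j : 'I_n,
        frobenius ((std_row i - std_row j) *m Y) ^+ 2
          <= X i i + X j j - 2 * X i j
    & forall i j : 'I_n,
        frobenius ((std_row i + std_row j) *m Y) ^+ 2
          <= X i i + X j j + 2 * X i j].

Definition penalized_obj P (Y0 : 'M[R]_(n, m)) (eta : R) Y X : R :=
  qlift (obj P) Y X
  + eta * \tr (X - 2 *: (Y0 *m Y^T) + Y0 *m Y0^T).

Definition penalized_optimal P (Y0 : 'M[R]_(n, m)) (eta : R) Y X : Prop :=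
  parabolic_feasible P Y X /\
  forall Y' X', parabolic_feasible P Y' X' ->
    penalized_obj P Y0 eta Y X <= penalized_obj P Y0 eta Y' X'.

End QCQP.

(* Main.v *)
Require Import Defs.
From HB Require Import structures.
From mathcomp Require Import all_boot all_order all_algebra.
From mathcomp Require Import all_classical all_reals.
From mathcomp Require Import topology normedtype.
From mathcomp Require derive.
From mathcomp Require Import ring lra.

Set Implicit Arguments.
Unset Strict Implicit.
Unset Printing Implicit Defensive.

Import Order.TTheory GRing.Theory Num.Theory.
Import numFieldNormedType.Exports.

Local Open Scope classical_set_scope.
Local Open Scope ring_scope.

(** The idea is to exhibit a point U of the original feasible set together
    with multipliers tau that satisfy the Karush-Kuhn-Tucker conditions for
    minimizing q_0(Y) + eta |Y - Y0|^2, and to show that they also solve the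
    relaxation. Relative to (U, U U^T), the Lagrangian of the relaxation is
    the matrix M = eta I + A_0 + sum_k tau_k A_k paired with
    X - Y Y^T + (Y - U)(Y - U)^T, whose two parts both satisfy the parabolic
    inequalities. These inequalities are dual to diagonal dominance, so
    everything follows, uniqueness included, once the column sums of
    A_0 + sum_k tau_k A_k are below eta, that is, once
    |A_0|_1 + rho1 |tau| < eta ([dominance_trace], [kkt_growth], [kkt_exact]).

    The small multipliers come from the quadratic penalty method instead of a
    constraint-qualification theorem. For every weight w, a minimizer Y_w of
    q_0(Y) + eta |Y - Y0|^2 + w (sum of squared violations) is an exact
    stationary point whose multipliers are 2 w times the violations. Comparison
    with a feasible point nearest to Y0 shows that
    |Y_w - Y0| <= r = d + (G + a d) / (eta - a), where d is the distance to the
    feasible set, G = |grad q_0(Y0)|_F and a = |A_0|_2 ([radius_bound],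
    [penalty_point]). The second lower bound on eta makes every constraint that
    is not quasi-binding strictly satisfied within this radius
    ([strictly_inactive]), so that its multiplier is 0. The gradients of the
    quasi-binding constraints at Y0 are independent in the quantitative sense
    measured by s(Y0), and transporting stationarity from Y_w to Y0 gives
    (s(Y0) - 2 rho2 r) |tau| <= G + 2 (a + eta) r ([sigma_min_le],
    [jacobian_lower], [multiplier_bound]). The first lower bound on eta is
    what turns this into |A_0|_1 + rho1 |tau| < eta ([multiplier_threshold]).

    The bound does not depend on w, so as w grows the violations tend to 0,
    and a cluster point of the pairs (Y_w, tau_w) satisfies the
    Karush-Kuhn-Tucker conditions with the same bound on the multipliers
    ([kkt_limit]). Finally, comparing U with the nearest feasible point, which
    is at least as close to Y0, gives the estimate on q_0(U). *)

(** * Compactness and continuity over finite-dimensional spaces *)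

Section Compactness.
Context {R : realType}.

(** A cluster point of approximate solutions solves the limit problem: every
    continuous function whose value is at most a multiple of the accuracy
    along the approximations is nonpositive there. One point has to serve for
    all the conditions g at once, so g is quantified after x. *)
Lemma compact_limit (T : topologicalType) (K : set T) (Q : R -> T -> Prop) :
  compact K -> (forall e, 0 < e -> exists x, K x /\ Q e x) ->
  exists x, K x /\ forall g : T -> R, continuous g ->
    (exists C, forall e y, 0 < e -> Q e y -> g y <= C * e) -> g x <= 0.
Proof.
move=> cK hQ.
have hn (i : nat) : 0 < i.+1%:R^-1 :> R by rewrite invr_gt0 ltr0n.
have [y hy] := choice (fun i => hQ _ (hn i)).
have [|x [Kx xcl]] := cK (y @ \oo) _.
  by exists 0%N => // i _ /=; case: (hy i).
exists x; split=> // g cg [C hC]; rewrite leNgt; apply/negP => gx0.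
pose D := `|C| + 1.
have D0 : 0 < D by rewrite ltr_pwDr.
have h1 : nbhs x [set z | g x / 2 < g z].
  by apply: (cvgr_gt (g x) (cg x)); lra.
pose N := Num.truncn (2 * D / g x).
have h2 : (y @ \oo) [set z | exists2 i, (N <= i)%N & z = y i].
  by exists N => // i /= Ni; exists i.
have [z [[i Ni ->] /=]] := xcl _ _ h2 h1.
case: (hy i) => _ /(hC _ _ (hn i)) h3 h4.
have : 2 * D / g x < i.+1%:R.
  have := truncnS_gt (2 * D / g x); rewrite -/N => /lt_le_trans; apply.
  by rewrite ler_nat.
rewrite ltr_pdivrMr // => h5.
have i0 : 0 < i.+1%:R :> R by rewrite ltr0n.
have : g x / 2 * i.+1%:R < C.
  by rewrite -ltr_pdivlMr //; apply: lt_le_trans h3.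
have : C <= `|C| by apply: ler_norm.
rewrite /D in h5; nra.
Qed.

(** Points are coordinate functions rather than row vectors so that one lemma
    covers matrices, matrices paired with multipliers, and spheres, in every
    dimension including 0. *)
Lemma box_compact (J : eqType) (b : R) :
  compact [set x : {ptws J -> R} | forall j, `|x j| <= b].
Proof.
have -> : [set x : {ptws J -> R} | forall j, `|x j| <= b] =
  [set x | forall j, `[- b, b]%classic (x j)].
  by apply/seteqP; split=> x h j; have := h j; rewrite /= in_itv /= ler_norml.
apply: (@tychonoff J (fun=> R) (fun=> `[- b, b]%classic)) => j.
exact: segment_compact.
Qed.

Lemma coord_cont (J : eqType) (j : J) :
  continuous (fun x : {ptws J -> R} => x j).
Proof. exact: (@proj_continuous J (fun=> R) j). Qed.

Section Cont.
Context {T : topologicalType}.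
Implicit Types f g : T -> R.

Lemma cont_cst (c : R) : continuous (fun _ : T => c).
Proof. by move=> x; exact: cvg_cst. Qed.

Lemma contD f g : continuous f -> continuous g ->
  continuous (fun x => f x + g x).
Proof. by move=> cf cg x; apply: cvgD; [exact: cf|exact: cg]. Qed.

Lemma contN f : continuous f -> continuous (fun x => - f x).
Proof. by move=> cf x; apply: cvgN; exact: cf. Qed.

Lemma contM f g : continuous f -> continuous g ->
  continuous (fun x => f x * g x).
Proof. by move=> cf cg x; apply: cvgM; [exact: cf|exact: cg]. Qed.

Lemma cont_sqr f :
  continuous f -> continuous (fun x => f x ^+ 2).
Proof. by move=> cf; under eq_fun do rewrite expr2; exact: contM. Qed.

Lemma cont_sum (J : Type) (s : seq J) (P : pred J) (F : J -> T -> R) :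
  (forall j, continuous (F j)) -> continuous (fun x => \sum_(j <- s | P j) F j x).
Proof.
move=> cF; elim: s => [|j s ih].
  rewrite (_ : (fun _ => _) = fun=> 0); first exact: cont_cst.
  by apply/funext => x; rewrite big_nil.
case Pj : (P j).
  rewrite (_ : (fun _ => _) = fun x => F j x + \sum_(j <- s | P j) F j x).
    exact: contD.
  by apply/funext => x; rewrite big_cons Pj.
by under eq_fun => x do rewrite big_cons Pj.
Qed.

Lemma cont_max0 f : continuous f -> continuous (fun x => Num.max (f x) 0).
Proof.
move=> cf.
have -> : (fun x => Num.max (f x) 0) = fun x => (f x + `|f x|) / 2.
  by apply/funext => x; rewrite /=; case: (leP (f x) 0) => h;
    [rewrite ler0_norm // | rewrite gtr0_norm //]; lra.
apply: (@contM (fun x => f x + `|f x|) (fun=> 2^-1)); last exact: cont_cst.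
by apply: contD => // x; apply: cvg_norm; exact: cf.
Qed.

(** Entrywise continuity spares any discussion of a topology on matrices: all
    the functions that occur are assembled from finitely many entries. *)
Definition contmx p q (M : T -> 'M[R]_(p, q)) :=
  forall i j, continuous (fun x => M x i j).

Lemma contmx_cst p q (A : 'M[R]_(p, q)) : contmx (fun _ : T => A).
Proof. by move=> i j; exact: cont_cst. Qed.

Lemma contmxD p q (A B : T -> 'M[R]_(p, q)) :
  contmx A -> contmx B -> contmx (fun x => A x + B x).
Proof.
by move=> cA cB i j; under eq_fun => x do rewrite mxE; exact: contD.
Qed.

Lemma contmxZ p q (f : T -> R) (A : T -> 'M[R]_(p, q)) :
  continuous f -> contmx A -> contmx (fun x => f x *: A x).
Proof.
by move=> cf cA i j; under eq_fun => x do rewrite mxE; exact: contM.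
Qed.

Lemma contmxM p q r (A : T -> 'M[R]_(p, q)) (B : T -> 'M[R]_(q, r)) :
  contmx A -> contmx B -> contmx (fun x => A x *m B x).
Proof.
move=> cA cB i j; under eq_fun => x do rewrite mxE.
by apply: cont_sum => k; exact: contM.
Qed.

Lemma contmxT p q (A : T -> 'M[R]_(p, q)) : contmx A -> contmx (fun x => (A x)^T).
Proof. by move=> cA i j; under eq_fun => x do rewrite mxE; exact: cA. Qed.

Lemma contmx_sum (J : Type) (s : seq J) (P : pred J) p q
    (F : J -> T -> 'M[R]_(p, q)) :
  (forall j, contmx (F j)) -> contmx (fun x => \sum_(j <- s | P j) F j x).
Proof.
move=> cF i j; under eq_fun => x do rewrite summxE.
by apply: cont_sum => k; exact: cF.
Qed.

Lemma cont_tr p (A : T -> 'M[R]_p) : contmx A -> continuous (fun x => \tr (A x)).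
Proof. by move=> cA; apply: cont_sum. Qed.

Lemma closed_le0 (f : T -> R) : continuous f -> closed [set x | f x <= 0].
Proof. by move=> cf; apply: (@preimage_closed _ _ f [set x | x <= 0]) => //; exact: closed_le. Qed.

Lemma compact_min (K : set T) (f : T -> R) : K !=set0 -> compact K ->
  continuous f -> exists2 x, K x & forall y, K y -> f x <= f y.
Proof.
move=> K0 cK cf.
have [|x xK h] := derive.compact_EVT_min K0 cK (f := f).
  exact: continuous_subspaceT.
by exists x; [exact/set_mem|move=> y /mem_set; exact: h].
Qed.

End Cont.
End Compactness.

(** * Frobenius inner product and induced norms *)

Section InnerProduct.
Context {R : realType}.

Lemma sum_CauchySchwarz (T : finType) (a b : T -> R) :
  (\sum_k a k * b k) ^+ 2 <= (\sum_k a k ^+ 2) * (\sum_k b k ^+ 2).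
Proof.
have expand (c d : R) : \sum_k (c * a k - d * b k) ^+ 2 =
    c ^+ 2 * (\sum_k a k ^+ 2) - 2 * c * d * (\sum_k a k * b k)
    + d ^+ 2 * (\sum_k b k ^+ 2).
  rewrite !mulr_sumr -sumrB -big_split /=.
  by apply: eq_bigr => k _; ring.
move: expand.
set s := \sum_k a k * b k; set B := \sum_k b k ^+ 2; set A := \sum_k a k ^+ 2.
move=> expand.
have B0 : 0 <= B by apply: sumr_ge0 => k _; exact: sqr_ge0.
have h : 0 <= B * (A * B - s ^+ 2).
  have -> : B * (A * B - s ^+ 2) = \sum_k (B * a k - s * b k) ^+ 2.
    by rewrite expand; ring.
  by apply: sumr_ge0 => k _; exact: sqr_ge0.
have [B1|B1] := eqVneq B 0; last first.
  have B2 : 0 < B by rewrite lt_def B1.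
  by rewrite -subr_ge0 -(pmulr_rge0 _ B2).
have b0 k : b k = 0.
  have /eqP := B1; rewrite psumr_eq0 => [/allP /(_ k)|i _]; last exact: sqr_ge0.
  by rewrite mem_index_enum sqrf_eq0 => /(_ isT) /eqP.
rewrite B1 mulr0 /s big1 ?expr0n // => k _.
by rewrite b0 mulr0.
Qed.

Definition mxdot p q (A B : 'M[R]_(p, q)) : R := \tr (A^T *m B).

Lemma mxdotE p q (A B : 'M[R]_(p, q)) :
  mxdot A B = \sum_i \sum_j A i j * B i j.
Proof.
rewrite exchange_big /=; apply: eq_bigr => j _; rewrite mxE.
by apply: eq_bigr => i _; rewrite mxE.
Qed.

Lemma mxdotC p q (A B : 'M[R]_(p, q)) : mxdot A B = mxdot B A.
Proof. by rewrite /mxdot -mxtrace_tr trmx_mul trmxK. Qed.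

Lemma mxdotDr p q (A B C : 'M[R]_(p, q)) :
  mxdot A (B + C) = mxdot A B + mxdot A C.
Proof. by rewrite /mxdot mulmxDr mxtraceD. Qed.

Lemma mxdotZr p q c (A B : 'M[R]_(p, q)) : mxdot A (c *: B) = c * mxdot A B.
Proof. by rewrite /mxdot -scalemxAr mxtraceZ. Qed.

Lemma mxdotDl p q (A B C : 'M[R]_(p, q)) :
  mxdot (A + B) C = mxdot A C + mxdot B C.
Proof. by rewrite mxdotC mxdotDr !(mxdotC C). Qed.

Lemma mxdotZl p q c (A B : 'M[R]_(p, q)) : mxdot (c *: A) B = c * mxdot A B.
Proof. by rewrite mxdotC mxdotZr mxdotC. Qed.

Lemma mxdotNr p q (A B : 'M[R]_(p, q)) : mxdot A (- B) = - mxdot A B.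
Proof. by rewrite -scaleN1r mxdotZr mulN1r. Qed.

Lemma mxdotNl p q (A B : 'M[R]_(p, q)) : mxdot (- A) B = - mxdot A B.
Proof. by rewrite mxdotC mxdotNr mxdotC. Qed.

Lemma mxdot0l p q (A : 'M[R]_(p, q)) : mxdot 0 A = 0.
Proof. by rewrite -(scale0r 0) mxdotZl mul0r. Qed.

Lemma mxdot_suml (J : Type) (s : seq J) (Q : pred J) p q (F : J -> 'M[R]_(p, q)) A :
  mxdot (\sum_(j <- s | Q j) F j) A = \sum_(j <- s | Q j) mxdot (F j) A.
Proof.
elim/big_rec2 : _ => [|j x B _ <-]; first exact: mxdot0l.
by rewrite mxdotDl.
Qed.

Lemma mxdot_mull p q (M : 'M[R]_p) (A B : 'M[R]_(p, q)) :
  mxdot (M *m A) B = mxdot A (M^T *m B).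
Proof. by rewrite /mxdot trmx_mul mulmxA. Qed.

Lemma cont_mxdot (T : topologicalType) k l (A B : T -> 'M[R]_(k, l)) :
  contmx A -> contmx B -> continuous (fun x => mxdot (A x) (B x)).
Proof. by move=> cA cB; apply: cont_tr; apply: contmxM => //; exact: contmxT. Qed.

Lemma mxdot_ge0 p q (A : 'M[R]_(p, q)) : 0 <= mxdot A A.
Proof.
by rewrite mxdotE; apply: sumr_ge0 => i _; apply: sumr_ge0 => j _; rewrite -expr2 sqr_ge0.
Qed.

Lemma mxdot_eq0 p q (A : 'M[R]_(p, q)) : mxdot A A = 0 -> A = 0.
Proof.
have h0 i j : 0 <= A i j * A i j by rewrite -expr2 sqr_ge0.
move/eqP; rewrite mxdotE psumr_eq0 => [/allP h|i _]; last exact: sumr_ge0.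
apply/matrixP => i j; rewrite mxE; have := h i; rewrite mem_index_enum => /(_ isT).
rewrite psumr_eq0 // => /allP /(_ j); rewrite mem_index_enum => /(_ isT).
by rewrite -expr2 sqrf_eq0 => /eqP.
Qed.

Lemma frobeniusE p q (A : 'M[R]_(p, q)) : frobenius A = Num.sqrt (mxdot A A).
Proof.
by rewrite mxdotE; congr Num.sqrt; do 2!(apply: eq_bigr => ? _); rewrite expr2.
Qed.

Lemma frobenius_ge0 p q (A : 'M[R]_(p, q)) : 0 <= frobenius A.
Proof. exact: sqrtr_ge0. Qed.

Lemma sqr_frobenius p q (A : 'M[R]_(p, q)) : frobenius A ^+ 2 = mxdot A A.
Proof. by rewrite frobeniusE sqr_sqrtr // mxdot_ge0. Qed.

Lemma mxdot_CauchySchwarz p q (A B : 'M[R]_(p, q)) :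
  `|mxdot A B| <= frobenius A * frobenius B.
Proof.
rewrite !frobeniusE -sqrtrM ?mxdot_ge0 // -sqrtr_sqr ler_wsqrtr //.
rewrite !mxdotE !pair_bigA /=.
apply: le_trans (sum_CauchySchwarz _ _) _.
by rewrite le_eqVlt; apply/orP; left; apply/eqP; congr (_ * _); apply: eq_bigr.
Qed.

Lemma frobeniusZ p q c (A : 'M[R]_(p, q)) : frobenius (c *: A) = `|c| * frobenius A.
Proof.
by rewrite !frobeniusE mxdotZl mxdotZr mulrA -expr2 sqrtrM ?sqr_ge0 // sqrtr_sqr.
Qed.

Lemma frobeniusD p q (A B : 'M[R]_(p, q)) :
  frobenius (A + B) <= frobenius A + frobenius B.
Proof.
have h0 := frobenius_ge0; rewrite -(ler_pXn2r (n := 2)) ?nnegrE ?addr_ge0 //.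
rewrite sqr_frobenius mxdotDl !mxdotDr (mxdotC B A) sqrrD !sqr_frobenius.
have := mxdot_CauchySchwarz A B; have := ler_norm (mxdot A B); lra.
Qed.

Lemma le_entry_frobenius k l (M : 'M[R]_(k, l)) i j : `|M i j| <= frobenius M.
Proof.
rewrite -(@ler_pXn2r _ 2) ?nnegrE ?frobenius_ge0 // real_normK ?num_real //.
rewrite sqr_frobenius mxdotE (bigD1 i) //= (bigD1 j) //= -expr2 -addrA lerDl addr_ge0 //.
  by apply: sumr_ge0 => ? _; rewrite -expr2 sqr_ge0.
by apply: sumr_ge0 => ? _; apply: sumr_ge0 => ? _; rewrite -expr2 sqr_ge0.
Qed.

Lemma frobenius0 p q : frobenius (0 : 'M[R]_(p, q)) = 0.
Proof. by rewrite frobeniusE mxdot0l sqrtr0. Qed.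

Lemma frobenius_eq0 p q (A : 'M[R]_(p, q)) : frobenius A = 0 -> A = 0.
Proof.
by move=> h; apply: mxdot_eq0; rewrite -sqr_frobenius h expr0n.
Qed.

Lemma frobeniusN p q (A : 'M[R]_(p, q)) : frobenius (- A) = frobenius A.
Proof. by rewrite -scaleN1r frobeniusZ normrN1 mul1r. Qed.

Lemma frobeniusM p q r (A : 'M[R]_(p, q)) (B : 'M[R]_(q, r)) :
  frobenius (A *m B) <= frobenius A * frobenius B.
Proof.
rewrite /frobenius -sqrtrM; last first.
  by apply: sumr_ge0 => i _; apply: sumr_ge0 => j _; exact: sqr_ge0.
rewrite ler_wsqrtr // mulr_suml; apply: ler_sum => i _.
rewrite [X in _ * X]exchange_big mulr_sumr; apply: ler_sum => j _ /=.
by rewrite mxE; exact: sum_CauchySchwarz.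
Qed.

Lemma sqr_frobenius_col p q (A : 'M[R]_(p, q)) :
  frobenius A ^+ 2 = \sum_j frobenius (col j A) ^+ 2.
Proof.
rewrite sqr_frobenius mxdotE exchange_big; apply: eq_bigr => j _.
rewrite sqr_frobenius mxdotE; apply: eq_bigr => i _.
by rewrite big_ord1 !mxE.
Qed.

(** The supremum of a set without an upper bound or without elements is 0 by
    convention, which leaves only the case where it bounds an element. *)
Lemma sup_nonneg (A : set R) : (forall x, A x -> 0 <= x) -> 0 <= sup A.
Proof.
move=> h; have [hA|/sup_out -> //] := pselect (has_sup A).
have [[x Ax] _] := hA; apply: le_trans (h _ Ax) _.
by apply: ub_le_sup => //; case: hA.
Qed.

Lemma vnorm1_ge0 p (x : 'cV[R]_p) : 0 <= vnorm1 x.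
Proof. by apply: sumr_ge0. Qed.

Lemma opnorm1_ge0 p (M : 'M[R]_p) : 0 <= opnorm1 M.
Proof. by apply: sup_nonneg => _ [x _ <-]; exact: vnorm1_ge0. Qed.

Lemma opnorm2_ge0 p (M : 'M[R]_p) : 0 <= opnorm2 M.
Proof. by apply: sup_nonneg => _ [x _ <-]; exact: frobenius_ge0. Qed.

Lemma opnorm2_ub p (M : 'M[R]_p) :
  ubound [set vnorm2 (M *m x) | x in [set x | vnorm2 x <= 1]] (frobenius M).
Proof.
move=> _ [x /= x1 <-]; apply: le_trans (frobeniusM _ _) _.
by rewrite ler_piMr // frobenius_ge0.
Qed.

Lemma opnorm2_le_frobenius p (M : 'M[R]_p) : opnorm2 M <= frobenius M.
Proof.
apply: ge_sup; last exact: opnorm2_ub.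
by exists (vnorm2 (M *m 0)), 0 => //=; rewrite /vnorm2 frobenius0 ler01.
Qed.

(** A crude seminorm dominating the induced 1-norm: it certifies that the
    suprema defining that norm and the pencil norm are over bounded sets. *)
Definition entry_norm p q (M : 'M[R]_(p, q)) : R := \sum_i \sum_j `|M i j|.

Lemma opnorm1_ub p (M : 'M[R]_p) :
  ubound [set vnorm1 (M *m x) | x in [set x | vnorm1 x <= 1]] (entry_norm M).
Proof.
move=> _ [x /= x1 <-]; apply: ler_sum => i _; rewrite mxE.
apply: le_trans (ler_norm_sum _ _ _) _; apply: ler_sum => j _.
rewrite normrM ler_piMr //; apply: le_trans x1.
by rewrite /vnorm1 (bigD1 j) //= lerDl sumr_ge0.
Qed.

Lemma opnorm1_le_entry_norm p (M : 'M[R]_p) : opnorm1 M <= entry_norm M.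
Proof.
apply: ge_sup; last exact: opnorm1_ub.
exists (vnorm1 (M *m 0)), 0 => //=; rewrite /vnorm1 big1 ?ler01 // => i _.
by rewrite mxE normr0.
Qed.

(** The column is the image of a standard basis vector, which lies in the
    unit ball of the 1-norm. Diagonal dominance is stated through such sums. *)
Lemma colsum_le_opnorm1 p (M : 'M[R]_p) j : \sum_i `|M i j| <= opnorm1 M.
Proof.
apply: ub_le_sup; first by exists (entry_norm M); exact: opnorm1_ub.
exists (delta_mx j 0).
  rewrite /= /vnorm1 (bigD1 j) //= big1 ?addr0 ?mxE ?eqxx ?normr1 // => i ij.
  by rewrite mxE (negPf ij) normr0.
by rewrite -colE; apply: eq_bigr => i _; rewrite mxE.
Qed.

Lemma vnorm2_mul p (M : 'M[R]_p) (x : 'cV[R]_p) :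
  frobenius (M *m x) <= opnorm2 M * frobenius x.
Proof.
have [->|x0] := eqVneq x 0; first by rewrite mulmx0 !frobenius0 mulr0.
have fx0 : 0 < frobenius x.
  by rewrite lt_def frobenius_ge0 andbT; apply: contra_neq x0; exact: frobenius_eq0.
rewrite -ler_pdivrMr // -[X in _ / X]gtr0_norm // mulrC -normfV -frobeniusZ scalemxAr.
apply: ub_le_sup; first by exists (frobenius M); exact: opnorm2_ub.
exists ((frobenius x)^-1 *: x) => //=.
by rewrite /vnorm2 frobeniusZ normfV gtr0_norm // mulVf // gt_eqF.
Qed.

(** The squared Frobenius norm is additive over columns, so the inequality
    for vectors extends to matrices with any number of columns. *)
Lemma frobenius_opnorm2 p q (M : 'M[R]_p) (H : 'M[R]_(p, q)) :
  frobenius (M *m H) <= opnorm2 M * frobenius H.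
Proof.
have h0 := @frobenius_ge0; have hM := opnorm2_ge0 M.
rewrite -(ler_pXn2r (n := 2)) ?nnegrE ?mulr_ge0 // exprMn.
rewrite !sqr_frobenius_col mulr_sumr; apply: ler_sum => j _.
rewrite -exprMn lerXn2r ?nnegrE ?mulr_ge0 //.
by rewrite !colE -mulmxA; exact: vnorm2_mul.
Qed.

End InnerProduct.

(** * The smallest singular value as a Rayleigh quotient *)

Section SingularValue.
Context {R : realType}.

(** The first-order optimality condition in one variable: the sign of t D
    changes at 0 and, for small t, it dominates the quadratic term. *)
Lemma stationary (t0 D C : R) : 0 < t0 ->
  (forall t, `|t| <= t0 -> 0 <= t * D + t ^+ 2 * C) -> D = 0.
Proof.
move=> t00 h; apply/eqP/negPn/negP => D0.
have nD0 : 0 < `|D| by rewrite normr_gt0.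
have nC0 : 0 <= `|C| by [].
(* This makes u |C| at most 1/2 and u |D| at most t0, so that t = - u D is an
   admissible increment at which the linear term wins. *)
pose u : R := (2 * (`|C| + 1) + `|D| / t0)^-1.
have d0 : 0 < `|D| / t0 by rewrite divr_gt0.
have u0 : 0 < u by rewrite invr_gt0; lra.
have uE : u * (2 * (`|C| + 1) + `|D| / t0) = 1 by rewrite mulVf // gt_eqF //; lra.
have uC : u * C < 1.
  have : C <= `|C| by exact: ler_norm.
  nra.
have : 0 <= (- u * D) * D + (- u * D) ^+ 2 * C.
  apply: h; rewrite normrM normrN (gtr0_norm u0).
  have kE : `|D| = `|D| / t0 * t0 by rewrite divfK // gt_eqF.
  rewrite kE mulrA ler_piMl ?ltW //; nra.
have D2 : 0 < D ^+ 2 by rewrite exprn_even_gt0.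
have uC1 : 0 < 1 - u * C by lra.
have := mulr_gt0 (mulr_gt0 u0 uC1) D2; lra.
Qed.

(** The form |xJ|^2 attains its minimum lam on the unit sphere, at some v.
    Then |xJ|^2 - lam |x|^2 is a nonnegative form vanishing at v, hence its
    gradient vanishes there: v is an eigenvector of J J^T for lam. So the square
    root of lam is a singular value, at least the smallest one. *)
Lemma sigma_min_le p q (J : 'M[R]_(p, q)) (x : 'rV[R]_p) :
  sigma_min J * frobenius x <= frobenius (x *m J).
Proof.
have [->|x0] := eqVneq x 0; first by rewrite mul0mx !frobenius0 mulr0.
have dot_gt0 (w : 'rV[R]_p) : w != 0 -> 0 < mxdot w w.
  by move=> w0; rewrite lt_def mxdot_ge0 andbT; apply: contra_neq w0; exact: mxdot_eq0.
pose rowof (y : {ptws 'I_p -> R}) : 'rV[R]_p := \row_i y i.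
have rowofE (w : 'rV[R]_p) : rowof (fun i => w 0 i) = w.
  by apply/rowP => i; rewrite mxE.
have crow : contmx rowof.
  move=> i j; have -> : (fun y => rowof y i j) = (fun y => y j).
    by apply/funext => y; rewrite mxE.
  exact: coord_cont.
pose K := [set y : {ptws 'I_p -> R} | mxdot (rowof y) (rowof y) = 1].
have cdot : continuous (fun y : {ptws 'I_p -> R} => mxdot (rowof y) (rowof y)).
  by apply: cont_tr; apply: contmxM => //; exact: contmxT.
have cK : compact K.
  apply: subclosed_compact (@box_compact R 'I_p 1) _.
    apply: (@preimage_closed _ _ (fun y => mxdot (rowof y) (rowof y)) [set x | x = 1]).
      by move=> y _; exact: cdot.
    exact: closed_eq.
  move=> y /= Ky j; rewrite -(@ler_pXn2r _ 2) ?nnegrE // expr1n real_normK ?num_real //.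
  rewrite -Ky mxdotE big_ord1 (bigD1 j) //= !mxE -expr2 lerDl.
  by apply: sumr_ge0 => i _; rewrite -expr2 sqr_ge0.
have unitK (w : 'rV[R]_p) : w != 0 ->
    K (fun i => ((frobenius w)^-1 *: w) 0 i).
  move=> w0; rewrite /K /= rowofE mxdotZl mxdotZr -sqr_frobenius mulrA -expr2.
  rewrite -exprMn mulVf ?expr1n //; apply: contra_neq w0; exact: frobenius_eq0.
pose f (y : {ptws 'I_p -> R}) := mxdot (rowof y *m J) (rowof y *m J).
have cf : continuous f.
  apply: cont_tr; apply: contmxM; first apply: contmxT.
    by apply: contmxM => //; exact: contmx_cst.
  by apply: contmxM => //; exact: contmx_cst.
have K0 : K !=set0 by exists (fun i => ((frobenius x)^-1 *: x) 0 i); exact: unitK.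
have [z Kz zmin] := compact_min K0 cK cf.
set v := rowof z; set lam := f z.
have lam0 : 0 <= lam by exact: mxdot_ge0.
have rayleigh (w : 'rV[R]_p) : lam * mxdot w w <= mxdot (w *m J) (w *m J).
  have [->|w0] := eqVneq w 0; first by rewrite mul0mx !mxdot0l mulr0.
  have := zmin _ (unitK _ w0); rewrite -/lam /f rowofE -scalemxAl mxdotZl mxdotZr.
  rewrite mulrA -invfM -expr2 sqr_frobenius mulrC.
  by rewrite ler_pdivlMr ?dot_gt0.
have veig : v *m (J *m J^T) = lam *: v.
  apply/eqP; rewrite -subr_eq0; apply/eqP; set h := _ - _.
  have hE : mxdot (v *m J) (h *m J) - lam * mxdot v h = mxdot h h.
    rewrite {3}/h mxdotDl mxdotNl mxdotZl; congr (_ - _).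
    by rewrite /mxdot [in LHS]mulmxA mxtrace_mulC !trmx_mul trmxK !mulmxA.
  clearbody h; apply: mxdot_eq0; rewrite -hE.
  suff : 2 * (mxdot (v *m J) (h *m J) - lam * mxdot v h) = 0 by lra.
  apply: (@stationary 1 _ (mxdot (h *m J) (h *m J) - lam * mxdot h h)) => // t _.
  have := rayleigh (v + t *: h).
  rewrite !(mulmxDl, mxdotDl, mxdotDr, mxdotZl, mxdotZr, =^~ scalemxAl).
  rewrite (mxdotC h v) (mxdotC (h *m J) (v *m J)).
  have -> : mxdot v v = 1 by [].
  have -> : mxdot (v *m J) (v *m J) = lam by [].
  lra.
have v0 : v != 0.
  by apply/eqP => v0; have := Kz; rewrite /K /= -/v v0 mxdot0l => /eqP; rewrite eq_sym oner_eq0.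
have sle : sigma_min J <= Num.sqrt lam.
  apply: ge_inf; first by exists 0 => _ [a _ <-]; exact: sqrtr_ge0.
  by exists lam => //=; apply/eigenvalueP; exists v.
apply: le_trans (_ : Num.sqrt lam * frobenius x <= _).
  by rewrite ler_wpM2r // frobenius_ge0.
by rewrite !frobeniusE -sqrtrM // ler_wsqrtr // rayleigh.
Qed.

End SingularValue.

(** * Pencil norms, quadratic functions and diagonal dominance *)

Section Pencil.
Context {R : realType} {n m : nat} {E I : finType}.
Implicit Types (P : qcqp R n m E I) (tau : E + I -> R).

Definition l2norm (T : finType) (a : T -> R) : R := Num.sqrt (\sum_k a k ^+ 2).

Lemma l2norm_ge0 (T : finType) (a : T -> R) : 0 <= l2norm a.
Proof. exact: sqrtr_ge0. Qed.

Lemma sqr_l2norm (T : finType) (a : T -> R) : l2norm a ^+ 2 = \sum_k a k ^+ 2.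
Proof. by rewrite sqr_sqrtr //; apply: sumr_ge0 => k _; exact: sqr_ge0. Qed.

Lemma le_l2norm (T : finType) (a : T -> R) k : `|a k| <= l2norm a.
Proof.
rewrite -(@ler_pXn2r _ 2) ?nnegrE ?l2norm_ge0 // real_normK ?num_real // sqr_l2norm.
by rewrite (bigD1 k) //= lerDl; apply: sumr_ge0 => i _; exact: sqr_ge0.
Qed.

Lemma l2norm_normalize (T : finType) (a : T -> R) :
  (forall k, a k = 0) \/
  exists b, l2norm b = 1 /\ a = (fun k => l2norm a * b k).
Proof.
have [a0|a0] := eqVneq (l2norm a) 0.
  by left => k; apply/eqP; rewrite -normr_le0 -a0 le_l2norm.
right; exists (fun k => (l2norm a)^-1 * a k); split; last first.
  by apply/funext => k; rewrite mulVKf.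
rewrite {1}/l2norm; under eq_bigr do rewrite exprMn.
by rewrite -mulr_sumr -sqr_l2norm -exprMn mulVf // expr1n sqrtr1.
Qed.

Lemma pencilZ P c tau : pencil P (fun k => c * tau k) = c *: pencil P tau.
Proof. by rewrite /pencil scaler_sumr; apply: eq_bigr => k _; rewrite scalerA. Qed.

Lemma pencil0 P tau : (forall k, tau k = 0) -> pencil P tau = 0.
Proof. by move=> h; rewrite /pencil big1 // => k _; rewrite h scale0r. Qed.

Lemma pencil_sym P tau : (pencil P tau)^T = pencil P tau.
Proof.
by rewrite /pencil linear_sum; apply: eq_bigr => k _; rewrite linearZ /= qA_sym.
Qed.

(** Both pencil norms are suprema over unit multipliers, whereas the proof
    needs them for arbitrary ones; this is the reduction by homogeneity. *)
Lemma pencil_normalize P tau :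
  pencil P tau = 0 \/
  exists b, l2norm b = 1 /\ pencil P tau = l2norm tau *: pencil P b.
Proof.
have [t0|[b [b1 tauE]]] := l2norm_normalize tau; first by left; exact: pencil0.
by right; exists b; split=> //; rewrite {1}tauE pencilZ.
Qed.

(** A supremum bounds its elements only if it is taken over a bounded set; any
    seminorm nu dominating N bounds it here, because the coordinates of a unit
    multiplier are at most 1 in absolute value. *)
Lemma pencil_norm_ub P (N nu : 'M[R]_n -> R) tau :
  (forall M, N M <= nu M) -> (forall M, 0 <= nu M) ->
  (forall A B, nu (A + B) <= nu A + nu B) ->
  (forall c A, nu (c *: A) = `|c| * nu A) ->
  l2norm tau = 1 -> N (pencil P tau) <= pencil_norm P N.
Proof.
move=> Nnu nu_ge0 nuD nuZ tau1; apply: ub_le_sup; last by exists tau.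
exists (\sum_k nu (qA (con P k))) => _ [t /= t1 <-]; apply: le_trans (Nnu _) _.
rewrite /pencil; elim/big_rec2 : _ => [|k x M _ IH].
  by rewrite -(scale0r 0) nuZ normr0 mul0r.
apply: le_trans (nuD _ _) _; apply: lerD => //; rewrite nuZ ler_piMl //.
by rewrite -t1; exact: le_l2norm.
Qed.

Lemma entry_normD (A B : 'M[R]_n) : entry_norm (A + B) <= entry_norm A + entry_norm B.
Proof.
rewrite -big_split; apply: ler_sum => i _; rewrite -big_split; apply: ler_sum => j _.
by rewrite mxE ler_normD.
Qed.

Lemma entry_normZ c (A : 'M[R]_n) : entry_norm (c *: A) = `|c| * entry_norm A.
Proof.
rewrite /entry_norm mulr_sumr; apply: eq_bigr => i _.
by rewrite mulr_sumr; apply: eq_bigr => j _; rewrite mxE normrM.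
Qed.

Lemma pencil_norm_ge0 P (N : 'M[R]_n -> R) :
  (forall M, 0 <= N M) -> 0 <= pencil_norm P N.
Proof. by move=> h; apply: sup_nonneg => _ [t _ <-]. Qed.

Lemma pencil_colsum P tau j : \sum_i `|pencil P tau i j| <= rho1 P * l2norm tau.
Proof.
have [->|[b [b1 ->]]] := pencil_normalize P tau.
  rewrite big1 => [|i _]; last by rewrite mxE normr0.
  by rewrite mulr_ge0 ?l2norm_ge0 // pencil_norm_ge0 // => M; exact: opnorm1_ge0.
under eq_bigr do rewrite mxE normrM (ger0_norm (l2norm_ge0 _)).
rewrite -mulr_sumr mulrC ler_wpM2r ?l2norm_ge0 //.
apply: le_trans (colsum_le_opnorm1 _ _) _.
apply: (@pencil_norm_ub _ _ (@entry_norm _ n n)) => //.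
- exact: opnorm1_le_entry_norm.
- by move=> M; apply: sumr_ge0 => i _; exact: sumr_ge0.
- exact: entry_normD.
- exact: entry_normZ.
Qed.

Lemma pencil_mul P tau (H : 'M[R]_(n, m)) :
  frobenius (pencil P tau *m H) <= rho2 P * l2norm tau * frobenius H.
Proof.
have [->|[b [b1 ->]]] := pencil_normalize P tau.
  rewrite mul0mx frobenius0 !mulr_ge0 ?l2norm_ge0 ?frobenius_ge0 //.
  by rewrite pencil_norm_ge0 // => M; exact: opnorm2_ge0.
rewrite -scalemxAl frobeniusZ (ger0_norm (l2norm_ge0 _)) (mulrC (rho2 P)) -mulrA.
rewrite ler_wpM2l ?l2norm_ge0 //; apply: le_trans (frobenius_opnorm2 _ _) _.
rewrite ler_wpM2r ?frobenius_ge0 //.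
apply: (@pencil_norm_ub _ _ (@frobenius _ n n)) => //.
- exact: opnorm2_le_frobenius.
- exact: frobenius_ge0.
- exact: frobeniusD.
- exact: frobeniusZ.
Qed.

Lemma frobenius_mxvec p q (M : 'M[R]_(p, q)) : frobenius (mxvec M) = frobenius M.
Proof.
rewrite /frobenius big_ord1; congr Num.sqrt.
rewrite pair_bigA /= (reindex _ (curry_mxvec_bij _ _)) /=.
by apply: eq_bigr => -[i j] _ /=; rewrite mxvecE.
Qed.

(** Row combinations of the Jacobian are, up to vectorization, the combinations
    of the constraint gradients whose coefficients are supported on B. *)
Lemma jacobian_lower P (B : {set E + I}) tau (Y : 'M[R]_(n, m)) :
  (forall k, k \notin B -> tau k = 0) ->
  sigma_min (jacobian P B Y) * l2norm tau <=
  frobenius (\sum_k tau k *: qgrad (con P k) Y).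
Proof.
move=> supp; pose x : 'rV[R]_#|B| := \row_i tau (enum_val i).
have <- : frobenius x = l2norm tau.
  rewrite /frobenius /l2norm big_ord1; congr Num.sqrt.
  rewrite [RHS](bigID (mem B)) /= [X in _ + X]big1 ?addr0 => [|k kB].
    by rewrite [RHS]big_enum_val; apply: eq_bigr => i _; rewrite mxE.
  by rewrite supp // expr0n.
have <- : frobenius (x *m jacobian P B Y) =
    frobenius (\sum_k tau k *: qgrad (con P k) Y).
  rewrite -(frobenius_mxvec (\sum_k _)); congr frobenius.
  rewrite mulmx_sum_row [in RHS](bigID (mem B)) /= [X in _ + X]big1 ?addr0 => [|k kB].
    rewrite [in RHS]big_enum_val linear_sum; apply: eq_bigr => i _.
    by rewrite rowK [x _ _]mxE [RHS]linearZ.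
  by rewrite supp // scale0r.
exact: sigma_min_le.
Qed.

End Pencil.

Section Quadratics.
Context {R : realType} {n m : nat}.
Implicit Types (q : quadratic R n m) (Y H : 'M[R]_(n, m)).

Lemma qvalE q Y : qval q Y = mxdot Y (qA q *m Y) + 2 * mxdot (qB q) Y + qc q.
Proof. by rewrite /qval /mxdot mulmxA. Qed.

Lemma qval_shift q Y H :
  qval q (Y + H) = qval q Y + mxdot (qgrad q Y) H + mxdot H (qA q *m H).
Proof.
rewrite !qvalE mulmxDr !mxdotDl !mxdotDr /qgrad mxdotZl mxdotDl.
by rewrite (mxdotC H (qA q *m Y)) mxdot_mull qA_sym; ring.
Qed.

Lemma qgrad_shift q Y H : qgrad q (Y + H) = qgrad q Y + 2 *: (qA q *m H).
Proof. by rewrite /qgrad mulmxDr addrAC scalerDr. Qed.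

Lemma mxdot_opnorm2 (A : 'M[R]_n) H :
  `|mxdot H (A *m H)| <= opnorm2 A * frobenius H ^+ 2.
Proof.
apply: le_trans (mxdot_CauchySchwarz _ _) _.
rewrite mulrC expr2 mulrA ler_wpM2r ?frobenius_ge0 //; exact: frobenius_opnorm2.
Qed.

Lemma qval_le q Y H :
  qval q (Y + H) <= qval q Y + frobenius (qgrad q Y) * frobenius H
                    + opnorm2 (qA q) * frobenius H ^+ 2.
Proof.
rewrite qval_shift lerD ?lerD //.
  exact: le_trans (ler_norm _) (mxdot_CauchySchwarz _ _).
exact: le_trans (ler_norm _) (mxdot_opnorm2 _ _).
Qed.

Lemma qval_ge q Y H :
  qval q Y - frobenius (qgrad q Y) * frobenius H - opnorm2 (qA q) * frobenius H ^+ 2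
  <= qval q (Y + H).
Proof.
have := mxdot_CauchySchwarz (qgrad q Y) H; have := mxdot_opnorm2 (qA q) H.
by rewrite !ler_norml qval_shift => /andP[h1 _] /andP[h2 _]; lra.
Qed.

Lemma cont_qval (T : topologicalType) q (Yf : T -> 'M[R]_(n, m)) :
  contmx Yf -> continuous (fun x => qval q (Yf x)).
Proof.
move=> cY; apply: contD; last exact: cont_cst.
apply: contD.
  by apply: cont_tr; apply: contmxM => //; apply: contmxM; [exact: contmxT|exact: contmx_cst].
apply: contM; first exact: cont_cst.
by apply: cont_tr; apply: contmxM => //; exact: contmx_cst.
Qed.

End Quadratics.

Section Certificate.
Context {R : realType}.

(** The hypotheses on Z say that it is nonnegative against (e_i + e_j)(e_i +
    e_j)^T and (e_i - e_j)(e_i - e_j)^T, that is, |Z_ij| <= (Z_ii + Z_jj) / 2.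
    Bounding every off-diagonal product this way and using the symmetry of N
    leaves the column sums of N against the diagonal of Z. In particular
    eta I + N pairs nonnegatively with Z as soon as c <= eta. *)
Lemma dominance_trace p (N Z : 'M[R]_p) c : N^T = N -> Z^T = Z ->
  (forall j, \sum_i `|N i j| <= c) ->
  (forall i j, 0 <= Z i i + Z j j - 2 * Z i j) ->
  (forall i j, 0 <= Z i i + Z j j + 2 * Z i j) ->
  - (c * \tr Z) <= \tr (N *m Z).
Proof.
move=> symN symZ hc hm hp.
have NC i j : N i j = N j i by rewrite -{1}symN mxE.
have ZC i j : Z i j = Z j i by rewrite -{1}symZ mxE.
have Zii i : 0 <= Z i i by have := hp i i; lra.
have col : \sum_i \sum_j `|N j i| * Z i i <= c * \tr Z.
  rewrite /mxtrace mulr_sumr; apply: ler_sum => i _.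
  by rewrite -mulr_suml ler_wpM2r.
have : \sum_i \sum_j (`|N j i| * Z i i + `|N i j| * Z j j) = 
    2 * \sum_i \sum_j `|N j i| * Z i i.
  under eq_bigr do rewrite big_split /=.
  rewrite big_split /= [X in _ + X]exchange_big /=.
  by rewrite mulr_natl mulr2n.
move=> sumE.
suff : - (\sum_i \sum_j (`|N j i| * Z i i + `|N i j| * Z j j)) <= 2 * \tr (N *m Z).
  by rewrite sumE; lra.
rewrite /mxtrace mulr_sumr -sumrN; apply: ler_sum => i _.
rewrite mxE mulr_sumr -sumrN; apply: ler_sum => j _.
rewrite (NC j i) (ZC j i) -mulrDr -mulrN.
have h : `|2 * Z i j| <= Z i i + Z j j.
  by rewrite ler_norml; have := hm i j; have := hp i j; lra.
rewrite mulrN mulrCA; apply: le_trans (_ : - (`|N i j| * `|2 * Z i j|) <= _).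
  by rewrite lerN2 ler_wpM2l.
by rewrite -normrM lerNl -normrN ler_norm.
Qed.

(** For s = 1 and s = -1 this says that X = Y Y^T turns the parabolic
    inequalities into equalities. *)
Lemma frobenius_row_comb n m (Y : 'M[R]_(n, m)) i j (s : R) :
  s ^+ 2 = 1 ->
  frobenius ((std_row i + s *: std_row j) *m Y) ^+ 2 =
  (Y *m Y^T) i i + (Y *m Y^T) j j + 2 * s * (Y *m Y^T) i j.
Proof.
move=> s2; have gram k l : mxdot (std_row k *m Y) (std_row l *m Y) = (Y *m Y^T) k l.
  rewrite -!rowE mxdotE big_ord1 mxE; apply: eq_bigr => t _; by rewrite !mxE.
rewrite sqr_frobenius mulmxDl -scalemxAl mxdotDl !mxdotDr !mxdotZr !mxdotZl.
rewrite (mxdotC (std_row j *m Y) (std_row i *m Y)) !gram.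
have -> : s * (s * (Y *m Y^T) j j) = s ^+ 2 * (Y *m Y^T) j j by ring.
by rewrite s2; ring.
Qed.

End Certificate.

(** * Multipliers that certify exactness of the relaxation *)

Section Exactness.
Context {R : realType} {n m : nat} {E I : finType}.
Variables (P : qcqp R n m E I) (Y0 : 'M[R]_(n, m)) (eta : R).
Implicit Types (q : quadratic R n m) (Y H : 'M[R]_(n, m)) (X : 'M[R]_n).

Fact penalized_quad_sym : (qA (obj P) + eta%:M)^T = qA (obj P) + eta%:M.
Proof. by rewrite linearD /= qA_sym tr_scalar_mx. Qed.

(** On X = Y Y^T the penalized objective is q_0(Y) + eta |Y - Y0|^2. Being
    again a quadratic function of Y, it is treated by the same lemmas as the
    constraints, its lifting being the penalized objective itself. *)
Definition penalized_quad : quadratic R n m :=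
  Quadratic (qB (obj P) - eta *: Y0) (qc (obj P) + eta * mxdot Y0 Y0)
    penalized_quad_sym.

Lemma penalized_quad_lift Y X : qlift penalized_quad Y X = penalized_obj P Y0 eta Y X.
Proof.
rewrite /penalized_obj /qlift /= -!/(mxdot _ _) mulmxDl mul_scalar_mx.
rewrite !mxtraceD mxtraceZ linearN /= mxtraceZ mxdotDl mxdotNl mxdotZl.
by rewrite (mxtrace_mulC Y0) (mxtrace_mulC Y0 Y0^T) -!/(mxdot _ _) (mxdotC Y); ring.
Qed.

Lemma penalized_quad_grad Y :
  qgrad penalized_quad Y = qgrad (obj P) Y + (2 * eta) *: (Y - Y0).
Proof.
rewrite /qgrad /= mulmxDl mul_scalar_mx -!scalerA -scalerDr; congr (_ *: _).
by rewrite scalerBr addrACA.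
Qed.

Lemma qlift_rank q Y : qlift q Y (Y *m Y^T) = qval q Y.
Proof. by rewrite /qlift /qval mulmxA mxtrace_mulC mulmxA. Qed.

Lemma penalized_quad_val Y :
  qval penalized_quad Y = qval (obj P) Y + eta * frobenius (Y - Y0) ^+ 2.
Proof.
rewrite sqr_frobenius mxdotDl !mxdotDr !(mxdotNl, mxdotNr) opprK.
rewrite !qvalE /= mulmxDl mul_scalar_mx mxdotDr mxdotZr mxdotDl mxdotNl mxdotZl.
by rewrite (mxdotC Y Y0); ring.
Qed.

(** Expansion of a lifted quadratic around the exactly lifted point
    (Y', Y' Y'^T): besides the first-order term in Y - Y', the only remainder is
    qA q paired with the lifting slack X - Y Y^T plus (Y - Y')(Y - Y')^T. *)
Lemma qlift_gap q Y Y' X :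
  qlift q Y X - qlift q Y' (Y' *m Y'^T) =
  \tr (qA q *m (X - Y *m Y^T + (Y - Y') *m (Y - Y')^T))
  + mxdot (qgrad q Y') (Y - Y').
Proof.
have gram H : \tr (qA q *m (H *m H^T)) = mxdot H (qA q *m H).
  by rewrite mulmxA mxtrace_mulC.
rewrite /qlift -!/(mxdot _ _) !mulmxDr mulmxN !mxtraceD linearN /= !gram.
rewrite /qgrad mxdotZl mulmxDr mulmxN.
rewrite !(mxdotDl, mxdotDr, mxdotNl, mxdotNr) mxdot_mull qA_sym.
rewrite (mxdotC (qA q *m Y') Y').
have -> : mxdot Y (qA q *m Y') = mxdot Y' (qA q *m Y).
  by rewrite mxdotC mxdot_mull qA_sym.
ring.
Qed.

Lemma parabolic_rank Y : feasible P Y -> parabolic_feasible P Y (Y *m Y^T).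
Proof.
move=> [fE fI]; split.
- by rewrite trmx_mul trmxK.
- by move=> k; rewrite qlift_rank.
- by move=> k; rewrite qlift_rank.
- move=> i j; rewrite -[- std_row j]scaleN1r frobenius_row_comb; last by rewrite sqrrN expr1n.
  lra.
- move=> i j; rewrite -[X in _ + X]scale1r frobenius_row_comb; last by rewrite expr1n.
  lra.
Qed.

(** The Karush-Kuhn-Tucker conditions for minimizing the penalized quadratic
    over the feasible set of the original, nonconvex problem. *)
Definition kkt Y (tau : E + I -> R) : Prop :=
  [/\ feasible P Y, forall k : I, 0 <= tau (inr k),
      forall k, tau k * qval (con P k) Y = 0
    & qgrad penalized_quad Y + \sum_k tau k *: qgrad (con P k) Y = 0].

(** Lagrangian duality for the relaxation. Summing the expansion of the
    objective and of the constraints, weighted by tau, stationarity cancels the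
    first-order terms and leaves eta I + (A_0 + sum_k tau_k A_k) paired with W,
    the lifting slack of (Y', X') plus the Gram matrix of Y' - Y. Both parts
    of W satisfy the parabolic inequalities, and the column sums of
    A_0 + sum_k tau_k A_k are at most c, so this is at least (eta - c) tr W. *)
Lemma kkt_growth Y tau c : kkt Y tau ->
  opnorm1 (qA (obj P)) + rho1 P * l2norm tau <= c ->
  forall Y' X', parabolic_feasible P Y' X' ->
    penalized_obj P Y0 eta Y (Y *m Y^T)
    + (eta - c) * (\tr (X' - Y' *m Y'^T) + frobenius (Y' - Y) ^+ 2)
    <= penalized_obj P Y0 eta Y' X'.
Proof.
move=> [_ tau0 comp stat] hc Y' X' [symX' fE fI hm hp].
set H := Y' - Y; set W := X' - Y' *m Y'^T + H *m H^T.
have trW : \tr W = \tr (X' - Y' *m Y'^T) + frobenius H ^+ 2.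
  by rewrite /W mxtraceD sqr_frobenius; congr (_ + _); exact: mxtrace_mulC.
have symW : W^T = W.
  have h (A B : 'M[R]_n) : (A - B)^T = A^T - B^T by exact: linearB.
  by rewrite /W [LHS]linearD /= h symX' !trmx_mul !trmxK.
have lag : penalized_obj P Y0 eta Y' X' - penalized_obj P Y0 eta Y (Y *m Y^T)
    + \sum_k tau k * qlift (con P k) Y' X' = eta * \tr W
      + \tr ((qA (obj P) + pencil P tau) *m W).
  have h k : tau k * qlift (con P k) Y' X' =
      tau k * \tr (qA (con P k) *m W) + mxdot (tau k *: qgrad (con P k) Y) H.
    rewrite mxdotZl -mulrDr -qlift_gap mulrBr qlift_rank comp subr0 //.
  rewrite (eq_bigr _ (fun k _ => h k)) big_split /= -mxdot_suml.
  rewrite -!penalized_quad_lift qlift_gap -/H -/W.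
  have -> : \sum_k tau k * \tr (qA (con P k) *m W) = \tr (pencil P tau *m W).
    rewrite /pencil mulmx_suml linear_sum /=; apply: eq_bigr => k _.
    by rewrite -scalemxAl mxtraceZ.
  rewrite addrACA -mxdotDl stat mxdot0l addr0 /=.
  clearbody W; rewrite !mulmxDl !mxtraceD mul_scalar_mx mxtraceZ.
  ring.
have slack : \sum_k tau k * qlift (con P k) Y' X' <= 0.
  rewrite big_sumType /= [X in X + _]big1 ?add0r => [|k _]; last by rewrite fE mulr0.
  by apply: sumr_le0 => k _; rewrite mulr_ge0_le0.
have := @dominance_trace R n (qA (obj P) + pencil P tau) W c.
have -> : (qA (obj P) + pencil P tau)^T = qA (obj P) + pencil P tau.
  by rewrite linearD /= qA_sym pencil_sym.
have gapE i j (s : R) : s ^+ 2 = 1 -> W i i + W j j + 2 * s * W i j =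
    X' i i + X' j j + 2 * s * X' i j
    - frobenius ((std_row i + s *: std_row j) *m Y') ^+ 2
    + frobenius ((std_row i + s *: std_row j) *m H) ^+ 2.
  move=> s2; rewrite !frobenius_row_comb //.
  rewrite /W; move: (Y' *m Y'^T) (H *m H^T) => A B; rewrite !mxE; ring.
move=> /(_ erefl symW) dom.
suff : - (c * \tr W) <= \tr ((qA (obj P) + pencil P tau) *m W).
  rewrite -trW; lra.
apply: dom => [j|i j|i j].
- apply: le_trans hc; apply: le_trans (_ : \sum_i (`|qA (obj P) i j| + `|pencil P tau i j|) <= _).
    by apply: ler_sum => i _; rewrite mxE ler_normD.
  by rewrite big_split lerD ?colsum_le_opnorm1 ?pencil_colsum.
- have := gapE i j (-1); rewrite sqrrN expr1n scaleN1r => /(_ erefl).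
  have := hm i j; have := sqr_ge0 (frobenius ((std_row i - std_row j) *m H)); lra.
- have := gapE i j 1; rewrite expr1n scale1r => /(_ erefl).
  have := hp i j; have := sqr_ge0 (frobenius ((std_row i + std_row j) *m H)); lra.
Qed.

(** If the diagonal of the slack vanishes, the two inequalities for i, j bound
    its off-diagonal entries from both sides by 0. *)
Lemma parabolic_slack Y X : parabolic_feasible P Y X ->
  0 <= \tr (X - Y *m Y^T) /\ (\tr (X - Y *m Y^T) = 0 -> X = Y *m Y^T).
Proof.
move=> [symX _ _ hm hp]; set Z := X - _.
have gapm i j : 0 <= Z i i + Z j j - 2 * Z i j.
  have := hm i j; rewrite -[- std_row j]scaleN1r frobenius_row_comb; last by rewrite sqrrN expr1n.
  by rewrite /Z; move: (Y *m Y^T) => A; rewrite !mxE; lra.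
have gapp i j : 0 <= Z i i + Z j j + 2 * Z i j.
  have := hp i j; rewrite -[X in _ + X]scale1r frobenius_row_comb; last by rewrite expr1n.
  by rewrite /Z; move: (Y *m Y^T) => A; rewrite !mxE; lra.
have Zii i : 0 <= Z i i by have := gapp i i; lra.
split; first exact: sumr_ge0.
move/eqP; rewrite psumr_eq0 // => /allP Z0; apply/eqP; rewrite -subr_eq0 -/Z.
have {}Z0 i : Z i i = 0 by apply/eqP; apply: Z0; rewrite mem_index_enum.
apply/eqP/matrixP => i j; rewrite [RHS]mxE.
by have := gapm i j; have := gapp i j; rewrite !Z0; lra.
Qed.

(** When c < eta the growth term is positive unless X' is exactly the lifting
    of Y' and Y' = Y, whence both optimality and uniqueness. *)
Lemma kkt_exact Y tau : kkt Y tau ->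
  opnorm1 (qA (obj P)) + rho1 P * l2norm tau < eta ->
  penalized_optimal P Y0 eta Y (Y *m Y^T) /\
  forall Y' X', penalized_optimal P Y0 eta Y' X' -> Y' = Y /\ X' = Y *m Y^T.
Proof.
move=> kktY hc; have growth := kkt_growth kktY (lexx _).
set g := eta - _ in growth; have g0 : 0 < g by rewrite subr_gt0.
have [feasY _ _ _] := kktY; have pfY := parabolic_rank feasY.
split.
  split=> // Y' X' pf'; apply: le_trans (growth _ _ pf').
  rewrite lerDl; apply: mulr_ge0; first exact: ltW.
  by apply: addr_ge0; [case: (parabolic_slack pf')|exact: sqr_ge0].
move=> Y' X' [pf' opt']; have [tr0 trZ] := parabolic_slack pf'.
have := le_trans (growth _ _ pf') (opt' _ _ pfY).
rewrite gerDl pmulr_rle0 // => le0.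
have f0 := sqr_ge0 (frobenius (Y' - Y)).
have tr00 : \tr (X' - Y' *m Y'^T) = 0.
  lra.
have /frobenius_eq0/eqP : frobenius (Y' - Y) = 0.
  by apply/eqP; rewrite -sqrf_eq0; apply/eqP; lra.
rewrite subr_eq0 => /eqP YE; split => //.
by rewrite trZ // YE.
Qed.

End Exactness.

(** * Stationary points of the quadratic penalty *)

Section Penalty.
Context {R : realType} {n m : nat} {E I : finType}.
Variables (P : qcqp R n m E I) (Y0 : 'M[R]_(n, m)) (eta : R).
Implicit Types (q : quadratic R n m) (Y H : 'M[R]_(n, m)).

(** The squared positive part is continuously differentiable, with derivative
    2 u^+ that is 2-Lipschitz; this upper model of second order is all that is
    used of its differentiability. *)
Lemma sqr_pospart_shift (u v : R) :
  Num.max (u + v) 0 ^+ 2 <= Num.max u 0 ^+ 2 + 2 * Num.max u 0 * v + v ^+ 2.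
Proof.
have uv2 := sqr_ge0 (u + v); have v2 := sqr_ge0 v.
case: (leP u 0) => u0; case: (leP (u + v) 0) => uv0; try lra.
have v0 : 0 <= v by lra.
have nu0 : 0 <= - u by rewrite oppr_ge0.
by have := mulr_ge0 nu0 v0; have := mulr_ge0 nu0 (ltW uv0); lra.
Qed.

Definition violation (k : E + I) Y : R :=
  match k with
  | inl _ => qval (con P k) Y
  | inr _ => Num.max (qval (con P k) Y) 0
  end.

Lemma violation_feasible k Y : feasible P Y -> violation k Y = 0.
Proof. by case: k => k [fE fI] /=; [exact: fE|exact/max_idPr]. Qed.

Lemma sqr_violation_shift k Y H :
  violation k (Y + H) ^+ 2 <= violation k Y ^+ 2
    + 2 * violation k Y * (mxdot (qgrad (con P k) Y) H + mxdot H (qA (con P k) *m H))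
    + (mxdot (qgrad (con P k) Y) H + mxdot H (qA (con P k) *m H)) ^+ 2.
Proof.
case: k => k /=; rewrite qval_shift -addrA.
  by rewrite le_eqVlt; apply/orP; left; apply/eqP; ring.
exact: sqr_pospart_shift.
Qed.

Lemma cont_violation (T : topologicalType) k (Yf : T -> 'M[R]_(n, m)) :
  contmx Yf -> continuous (fun x => violation k (Yf x)).
Proof.
move=> cY; case: k => k /=; first exact: cont_qval.
by apply: cont_max0; exact: cont_qval.
Qed.

(** The hypotheses on f and C quantify over all entrywise continuous families
    so that the domain can be parametrized by coordinate functions, a space
    for which bounded boxes are compact. *)
Lemma ball_min (f : 'M[R]_(n, m) -> R) (C : set 'M[R]_(n, m)) (Yc : 'M[R]_(n, m)) (r : R) :
  (forall (T : topologicalType) (Yf : T -> 'M[R]_(n, m)),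
     contmx Yf -> continuous (fun x => f (Yf x))) ->
  (forall (T : topologicalType) (Yf : T -> 'M[R]_(n, m)),
     contmx Yf -> closed [set x | C (Yf x)]) ->
  (exists Y, C Y /\ frobenius (Y - Yc) <= r) ->
  exists Y, [/\ C Y, frobenius (Y - Yc) <= r &
    forall Y', C Y' -> frobenius (Y' - Yc) <= r -> f Y <= f Y'].
Proof.
move=> cf cC [Y1 [CY1 Y1r]].
have r0 : 0 <= r by apply: le_trans Y1r; exact: frobenius_ge0.
pose T := {ptws ('I_n * 'I_m)%type -> R}.
pose mat (x : T) : 'M[R]_(n, m) := \matrix_(i, j) x (i, j).
have cmat : contmx mat.
  move=> i j; have -> : (fun x => mat x i j) = (fun x => x (i, j)).
    by apply/funext => x; rewrite mxE.
  exact: coord_cont.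
have matE (M : 'M[R]_(n, m)) : mat (fun p => M p.1 p.2) = M by apply/matrixP => i j; rewrite mxE.
pose Yf x := Yc + mat x.
have cYf : contmx Yf by apply: contmxD => //; exact: contmx_cst.
have YfE Y : Yf (fun p => (Y - Yc) p.1 p.2) = Y by rewrite /Yf matE addrC subrK.
have ballE (M : 'M[R]_(n, m)) : (frobenius M <= r) = (mxdot M M - r ^+ 2 <= 0).
  by rewrite subr_le0 -sqr_frobenius ler_pXn2r ?nnegrE ?frobenius_ge0.
pose K := [set x : T | C (Yf x)] `&` [set x | mxdot (mat x) (mat x) - r ^+ 2 <= 0].
have cK : compact K.
  apply: subclosed_compact (@box_compact R _ r) _.
    apply: closedI; first exact: cC.
    apply: closed_le0; apply: contD; last exact: cont_cst.
    exact: cont_mxdot.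
  move=> x [_ /=]; rewrite -ballE => xr [i j]; apply: le_trans xr.
  by have := le_entry_frobenius (mat x) i j; rewrite mxE.
have inK Y : C Y -> frobenius (Y - Yc) <= r -> K (fun p => (Y - Yc) p.1 p.2).
  by move=> CY Yr; split; rewrite /= ?YfE // matE -ballE.
have K0 : K !=set0 by exists (fun p => (Y1 - Yc) p.1 p.2); exact: inK.
have [z [Cz zr] zmin] := compact_min K0 cK (cf _ _ cYf).
exists (Yf z); split=> //.
  by rewrite /Yf addrC addKr ballE.
by move=> Y' CY' Y'r; have := zmin _ (inK _ CY' Y'r); rewrite YfE.
Qed.

Lemma dist_attained : feasible P !=set0 ->
  exists2 Y, feasible P Y & frobenius (Y - Y0) = dist P Y0.
Proof.
move=> [Y1 fY1].
have [||Y [fY Yr Ymin]] := @ball_min (fun Y => mxdot (Y - Y0) (Y - Y0)) (feasible P)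
    Y0 (frobenius (Y1 - Y0)) _ _ (ex_intro _ Y1 (conj fY1 (lexx _))).
- by move=> T Yf cY; apply: cont_mxdot; apply: contmxD => //; exact: contmx_cst.
- move=> T Yf cY.
  have -> : [set x | feasible P (Yf x)] =
      \bigcap_(k in [set: E + I]) [set x | `|violation k (Yf x)| <= 0].
    apply/seteqP; split=> x /=.
      by move=> fx k _ /=; rewrite violation_feasible // normr0.
    move=> h; split=> k.
      by have /= := h (inl k) Logic.I; rewrite normr_le0 => /eqP.
    by have /= := h (inr k) Logic.I; rewrite normr_le0 => /eqP/max_idPr.
  apply: closed_bigI => k _; apply: closed_le0 => x.
  by apply: cvg_norm; exact: cont_violation.
exists Y => //; apply/le_anti/andP; split.
  apply: lb_le_inf; first by exists (frobenius (Y1 - Y0)), Y1.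
  move=> _ [Y' fY' <-]; case: (leP (frobenius (Y' - Y0)) (frobenius (Y1 - Y0))) => h.
    have := Ymin _ fY' h; rewrite -!sqr_frobenius.
    by rewrite ler_pXn2r ?nnegrE ?frobenius_ge0.
  exact: le_trans Yr (ltW h).
by apply: ge_inf; [exists 0 => _ [Z _ <-]; exact: frobenius_ge0|exists Y].
Qed.

Let d := dist P Y0.
Let a := opnorm2 (qA (obj P)).
Let g := frobenius (qgrad (obj P) Y0) + a * d.
Let pq := penalized_quad P Y0 eta.

(** With r the distance from Y to Y0 and G = |grad q_0(Y0)|_F, comparing the
    values of the penalized quadratic at Y and at a nearest feasible point gives
    (eta - a)(r^2 - d^2) <= G (r + d) + 2 a d^2. If r >= d the right-hand side
    is at most (G + a d)(r + d), and r + d cancels. *)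
Lemma radius_bound Y Yd : a < eta -> frobenius (Yd - Y0) = d ->
  qval pq Y <= qval pq Yd -> frobenius (Y - Y0) <= d + g / (eta - a).
Proof.
move=> ha hd; rewrite !penalized_quad_val hd.
have := qval_ge (obj P) Y0 (Y - Y0); have := qval_le (obj P) Y0 (Yd - Y0).
rewrite [Y0 + (Y - Y0)]addrC [Y0 + (Yd - Y0)]addrC !subrK hd -/a.
have d0 : 0 <= d by rewrite -hd frobenius_ge0.
have G0 := frobenius_ge0 (qgrad (obj P) Y0); have a0 : 0 <= a := opnorm2_ge0 _.
rewrite /g; move: (frobenius (qgrad _ _)) G0 => G G0.
move: (frobenius (Y - Y0)) => r h1 h2 h3.
rewrite leNgt; apply/negP => rd.
have e0 : 0 < eta - a by rewrite subr_gt0.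
have del0 : 0 <= (G + a * d) / (eta - a) 
  by apply: divr_ge0; [apply: addr_ge0 => //; exact: mulr_ge0|exact: ltW].
have delE : (G + a * d) / (eta - a) * (eta - a) = G + a * d by rewrite divfK // gt_eqF.
move: ((G + a * d) / (eta - a)) rd del0 delE => del rd del0 delE.
have rd1 : 0 < r + d by lra.
have k1 : (eta - a) * (r ^+ 2 - d ^+ 2) <= G * (r + d) + 2 * a * d ^+ 2 by lra.
have k2 : 2 * a * d ^+ 2 <= a * d * (r + d).
  have : 0 <= a * d * (r - d) by rewrite !mulr_ge0 //; lra.
  lra.
have : 0 < (eta - a) * (r - d - del) * (r + d) by rewrite !mulr_gt0 //; lra.
have : (G + a * d) * (r + d) = del * (eta - a) * (r + d) by rewrite delE.
lra.
Qed.

Let rh := d + g / (eta - a).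

(** The multipliers of the quadratic penalty method: Y minimizes the penalized
    quadratic plus w times the sum of squared violations. It is enough to
    minimize over the ball of radius rh + 1, because the minimum over it is
    no larger than the value at the nearest feasible point and hence is
    attained within distance rh, in the interior. *)
Lemma penalty_point (w : R) : a < eta -> feasible P !=set0 -> 0 < w ->
  exists Y, frobenius (Y - Y0) <= rh /\
    qgrad pq Y + \sum_k (2 * w * violation k Y) *: qgrad (con P k) Y = 0.
Proof.
move=> ha F0 w0; have [Yd fYd Ydd] := dist_attained F0; rewrite -/d in Ydd.
pose F Y := qval pq Y + w * \sum_k violation k Y ^+ 2.
have d0 : 0 <= d by rewrite -Ydd frobenius_ge0.
have a0 : 0 <= a := opnorm2_ge0 _.
have rhd : d <= rh.
  by rewrite lerDl divr_ge0 ?subr_ge0 ?(ltW ha) // addr_ge0 ?mulr_ge0 ?frobenius_ge0.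
have [|||Y [_ Yr Ymin]] := @ball_min F setT Y0 (rh + 1).
- move=> T Yf cY; apply: contD; first exact: cont_qval.
  apply: contM; first exact: cont_cst.
  by apply: cont_sum => k; apply: cont_sqr; exact: cont_violation.
- by move=> T Yf cY; exact: closedT.
- by exists Yd; split=> //; rewrite Ydd; lra.
have {}Yr : frobenius (Y - Y0) <= rh.
  apply: (radius_bound ha Ydd).
  have : F Y <= F Yd by apply: Ymin => //; rewrite Ydd; lra.
  rewrite /F [in X in _ <= X]big1 => [|k _]; last by rewrite violation_feasible // expr0n.
  rewrite mulr0 addr0; apply: le_trans; rewrite lerDl.
  by apply: mulr_ge0; [exact: ltW|apply: sumr_ge0 => k _; exact: sqr_ge0].
exists Y; split=> //; set V := _ + _; apply: mxdot_eq0.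
have VE H : mxdot V H = mxdot (qgrad pq Y) H
    + w * \sum_k 2 * violation k Y * mxdot (qgrad (con P k) Y) H.
  rewrite /V mxdotDl mxdot_suml mulr_sumr; congr (_ + _).
  by apply: eq_bigr => k _; rewrite mxdotZl; ring.
clearbody V; move: {2}V => H.
pose gk k := mxdot (qgrad (con P k) Y) H.
pose hk k := mxdot H (qA (con P k) *m H).
(* An upper bound, valid for |t| <= 1, on the coefficient of t^2 in the growth of
   F along the direction H. *)
pose C := mxdot H (qA pq *m H) + w * \sum_k (2 * violation k Y * hk k
            + (`|gk k| + `|hk k|) ^+ 2).
have nH : 0 < frobenius H + 1 by rewrite ltr_wpDl ?frobenius_ge0.
apply: (@stationary R (frobenius H + 1)^-1 _ C); first by rewrite invr_gt0.
move=> t ht.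
have tH : `|t| * (frobenius H + 1) <= 1 by rewrite -ler_pdivlMr // mul1r.
have t0 : 0 <= `|t| by [].
have fH := frobenius_ge0 H.
have t1 : `|t| <= 1 by nra.
have step : F Y <= F (Y + t *: H).
  apply: Ymin => //; rewrite addrAC; apply: le_trans (frobeniusD _ _) _.
  rewrite lerD // frobeniusZ; nra.
have upper : F (Y + t *: H) <= F Y + (t * mxdot V H + t ^+ 2 * C).
  rewrite /F qval_shift -/pq -scalemxAr (mxdotZr t (qgrad _ _)) (mxdotZl t H) (mxdotZr t H).
  have termle k : violation k (Y + t *: H) ^+ 2 <= violation k Y ^+ 2
      + t * (2 * violation k Y * gk k) + t ^+ 2 * (2 * violation k Y * hk k
            + (`|gk k| + `|hk k|) ^+ 2).
    apply: le_trans (sqr_violation_shift _ _ _) _.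
    rewrite -scalemxAr (mxdotZr t (qgrad _ _)) (mxdotZl t H) (mxdotZr t H) -/(gk k) -/(hk k).
    have sq : (gk k + t * hk k) ^+ 2 <= (`|gk k| + `|hk k|) ^+ 2.
      rewrite -(real_normK (num_real _)) lerXn2r ?nnegrE ?addr_ge0 //.
      apply: le_trans (ler_normD _ _) _; rewrite lerD // normrM ler_piMl //.
    move: (gk k) (hk k) (violation k Y) sq => x y v /(ler_wpM2l (sqr_ge0 t)) sq.
    lra.
  have := ler_sum (index_enum _) (fun k (_ : xpredT k) => termle k).
  rewrite big_split /= big_split /= -!mulr_sumr => /(ler_wpM2l (ltW w0)) sumle.
  rewrite VE /C -/(gk _). lra.
lra.
Qed.

End Penalty.

(** * Bounds on the multipliers and passage to the limit *)

Section Multipliers.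
Context {R : realType} {n m : nat} {E I : finType}.
Variables (P : qcqp R n m E I) (Y0 : 'M[R]_(n, m)) (eta : R).
Implicit Types (q : quadratic R n m) (Y H : 'M[R]_(n, m)) (tau : E + I -> R).

Let pq := penalized_quad P Y0 eta.

(** Stationarity at Y expresses the combination of constraint gradients through
    the gradient of the penalized quadratic. Moving these gradients back to Y0,
    where the singular value is known, costs 2 rho2 |tau| r. *)
Lemma multiplier_bound Y tau (B : {set E + I}) r :
  0 <= eta -> frobenius (Y - Y0) <= r -> (forall k, k \notin B -> tau k = 0) ->
  qgrad pq Y + \sum_k tau k *: qgrad (con P k) Y = 0 ->
  (sigma_min (jacobian P B Y0) - 2 * rho2 P * r) * l2norm tau <=
  frobenius (qgrad (obj P) Y0) + 2 * (opnorm2 (qA (obj P)) + eta) * r.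
Proof.
move=> eta0 Yr supp stat; set H := Y - Y0 in Yr.
have YE : Y = Y0 + H by rewrite addrC subrK.
have gradE : \sum_k tau k *: qgrad (con P k) Y0 =
    - (qgrad (obj P) Y0 + 2 *: (qA (obj P) *m H) + (2 * eta) *: H
       + 2 *: (pencil P tau *m H)).
  apply/eqP; rewrite -addr_eq0; apply/eqP; rewrite -[RHS]stat /pq penalized_quad_grad -/H.
  have -> : \sum_k tau k *: qgrad (con P k) Y =
      \sum_k tau k *: qgrad (con P k) Y0 + 2 *: (pencil P tau *m H).
    rewrite /pencil mulmx_suml scaler_sumr -big_split; apply: eq_bigr => k _ /=.
    by rewrite {1}YE qgrad_shift scalerDr -scalemxAl !scalerA mulrC.
  by rewrite {1}YE qgrad_shift addrCA.
have := jacobian_lower P Y0 supp; rewrite gradE frobeniusN => jac.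
have f0 := @frobenius_ge0 R.
have h1 := frobeniusD (qgrad (obj P) Y0 + 2 *: (qA (obj P) *m H) + (2 * eta) *: H)
  (2 *: (pencil P tau *m H)).
have h2 := frobeniusD (qgrad (obj P) Y0 + 2 *: (qA (obj P) *m H)) ((2 * eta) *: H).
have h3 := frobeniusD (qgrad (obj P) Y0) (2 *: (qA (obj P) *m H)).
have two0 : 0 <= 2 :> R by [].
rewrite [frobenius (2 *: (qA _ *m _))]frobeniusZ (ger0_norm two0) in h3.
rewrite [frobenius (_ *: H)]frobeniusZ (ger0_norm (mulr_ge0 two0 eta0)) in h2.
rewrite [frobenius (2 *: (pencil _ _ *m _))]frobeniusZ (ger0_norm two0) in h1.
have k1 : frobenius (qA (obj P) *m H) <= opnorm2 (qA (obj P)) * r.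
  apply: le_trans (frobenius_opnorm2 _ _) _.
  by rewrite ler_wpM2l // opnorm2_ge0.
have k2 : frobenius (pencil P tau *m H) <= rho2 P * l2norm tau * r.
  apply: le_trans (pencil_mul _ _ _) _; rewrite ler_wpM2l // mulr_ge0 ?l2norm_ge0 //.
  by apply: pencil_norm_ge0 => M; exact: opnorm2_ge0.
have k3 : eta * frobenius H <= eta * r by rewrite ler_wpM2l.
lra.
Qed.

(** As w grows, violations tau_k / (2 w) tend to 0 because the multipliers stay
    bounded, and a cluster point of the pairs (Y, tau) is feasible. All the other
    conditions hold along the way: multipliers of inequalities are nonnegative,
    and tau_k q_k(Y) >= 0 since a positive multiplier means a violated
    constraint; feasibility gives the opposite inequality in the limit. *)
Lemma kkt_limit (r T : R) :
  (forall w, 0 < w -> exists Y tau, [/\ frobenius (Y - Y0) <= r, l2norm tau <= T,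
      forall k, tau k = 2 * w * violation P k Y
    & qgrad pq Y + \sum_k tau k *: qgrad (con P k) Y = 0]) ->
  exists Y tau, kkt P Y0 eta Y tau /\ l2norm tau <= T.
Proof.
move=> happ.
pose J := (('I_n * 'I_m) + (E + I))%type.
pose S := {ptws J -> R}.
pose Yf (x : S) : 'M[R]_(n, m) := Y0 + \matrix_(i, j) x (inl (i, j)).
pose tf (x : S) (k : E + I) : R := x (inr k).
have cY : contmx Yf.
  apply: contmxD; first exact: contmx_cst.
  move=> i j.
  have -> : (fun x : S => (\matrix_(i, j) x (inl (i, j)) : 'M[R]_(n, m)) i j) =
      (fun x => x (inl (i, j))) by apply/funext => x; rewrite mxE.
  exact: coord_cont.
have ct k : continuous (fun x => tf x k) by exact: coord_cont.
have T0 : 0 <= T.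
  by have [Y [tau [_ h _ _]]] := happ 1 ltr01; apply: le_trans h; exact: l2norm_ge0.
pose Q e x := [/\ l2norm (tf x) <= T, forall k, violation P k (Yf x) = e * tf x k
  & qgrad pq (Yf x) + \sum_k tf x k *: qgrad (con P k) (Yf x) = 0].
have [|x [_ hx]] := @compact_limit R S _ Q (@box_compact R J (`|r| + T)).
  move=> e e0; have w0 : 0 < (2 * e)^-1 by rewrite invr_gt0 mulr_gt0.
  have [Y [tau [Yr tauT tauE stat]]] := happ _ w0.
  exists (fun j : J => match j with inl p => (Y - Y0) p.1 p.2 | inr k => tau k end).
  have YfE : Yf (fun j : J => match j with inl p => (Y - Y0) p.1 p.2 | inr k => tau k end) = Y.
    by apply/matrixP => i j; rewrite !mxE /=; ring.
  split.
    case=> [[i j]|k] /=.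
      apply: le_trans (le_entry_frobenius _ _ _) _; apply: le_trans Yr _.
      by apply: le_trans (ler_norm _) _; rewrite lerDl.
    by apply: le_trans (le_l2norm _ _) _; apply: le_trans tauT _; rewrite lerDr.
  split; rewrite /tf ?YfE // => k; rewrite tauE.
  by field; rewrite gt_eqF.
exists (Yf x), (tf x).
have tauT : l2norm (tf x) <= T.
  have : l2norm (tf x) ^+ 2 - T ^+ 2 <= 0.
    rewrite sqr_l2norm; apply: (hx (fun x => \sum_k tf x k ^+ 2 - T ^+ 2)).
      apply: contD; last exact: cont_cst.
      by apply: cont_sum => k; apply: cont_sqr.
    exists 0 => e y _ [yT _ _]; rewrite mul0r -sqr_l2norm subr_le0.
    by rewrite lerXn2r ?nnegrE ?l2norm_ge0.
  by rewrite subr_le0 ler_pXn2r ?nnegrE ?l2norm_ge0.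
have tle y k : l2norm (tf y) <= T -> `|tf y k| <= T.
  by apply: le_trans; exact: le_l2norm.
have viol_val k y : qval (con P (inr k)) y <= violation P (inr k) y by rewrite /= le_max lexx.
have stat_cont i j : continuous (fun x =>
    (qgrad pq (Yf x) + \sum_k tf x k *: qgrad (con P k) (Yf x)) i j).
  have cgrad q : contmx (fun x => qgrad q (Yf x)).
    apply: contmxZ; first exact: cont_cst.
    apply: contmxD; last exact: contmx_cst.
    by apply: contmxM => //; exact: contmx_cst.
  by apply: contmxD => //; apply: contmx_sum => k; exact: contmxZ.
have tau0 k : 0 <= tf x (inr k).
  rewrite -oppr_le0; apply: (hx (fun x => - tf x (inr k))).
    by apply: contN; exact: ct.
  exists 0 => e y e0 [_ hv _]; rewrite mul0r oppr_le0.
  rewrite -(pmulr_rge0 _ e0) -hv /= le_max lexx orbT //.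
have fE k : qval (con P (inl k)) (Yf x) = 0.
  apply/le_anti/andP; split.
    apply: (hx (fun x => qval (con P (inl k)) (Yf x))); first exact: cont_qval.
    exists T => e y e0 [yT hv _]; have /= -> := hv (inl k).
    by rewrite mulrC ler_wpM2r ?(ltW e0) // (le_trans (ler_norm _)) // tle.
  rewrite -oppr_le0; apply: (hx (fun x => - qval (con P (inl k)) (Yf x))).
    by apply: contN; exact: cont_qval.
  exists T => e y e0 [yT hv _]; have /= -> := hv (inl k).
  rewrite mulrC -mulNr ler_wpM2r ?(ltW e0) // (le_trans (ler_norm _)) // normrN tle //.
have fI k : qval (con P (inr k)) (Yf x) <= 0.
  apply: (hx (fun x => qval (con P (inr k)) (Yf x))); first exact: cont_qval.
  exists T => e y e0 [yT hv _]; apply: le_trans (viol_val _ _) _; rewrite hv.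
  by rewrite mulrC ler_wpM2r ?(ltW e0) // (le_trans (ler_norm _)) // tle.
split=> //; split=> //.
- case=> k; first by rewrite fE mulr0.
  apply/le_anti/andP; split; first by rewrite mulr_ge0_le0.
  rewrite -oppr_le0; apply: (hx (fun x => - (tf x (inr k) * qval (con P (inr k)) (Yf x)))).
    by apply: contN; apply: contM => //; exact: cont_qval.
  exists 0 => e y e0 [_ hv _]; rewrite mul0r oppr_le0 -(pmulr_rge0 _ e0) mulrA -hv /=.
  by case: (leP (qval _ _) 0) => [_|/ltW h]; rewrite ?mul0r // mulr_ge0.
- apply/matrixP => i j; rewrite [RHS]mxE; apply/le_anti/andP; split.
    apply: (hx _ (stat_cont i j)); exists 0 => e y _ [_ _ ->].
    by rewrite mxE mul0r.
  rewrite -oppr_le0; apply: (hx _ (contN (stat_cont i j))); exists 0 => e y _ [_ _ ->].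
  by rewrite mxE mul0r oppr0.
Qed.

(** Replacing the distance d by at most d + del raises the quadratic upper
    bound on q by at most (G + 2 a d) del + a del^2, where G = |grad q(Y0)|_F
    and a = |A|_2. In units of t this is v + u^2 with v = del (G + 2 a d) / t
    and u = del sqrt(a / t); the hypothesis is u + v < 1, so that u^2 <= u. *)
Lemma strictly_inactive q r d del t :
  0 <= del -> r <= d + del -> 0 <= r -> 0 <= d -> 0 < t ->
  forall Y, frobenius (Y - Y0) = r ->
  qval q Y0 + frobenius (qgrad q Y0) * d + opnorm2 (qA q) * d ^+ 2 = - t ->
  del * (Num.sqrt (opnorm2 (qA q) / t)
         + (frobenius (qgrad q Y0) + 2 * opnorm2 (qA q) * d) / t) < 1 ->
  qval q Y < 0.
Proof.
move=> del0 rle r0 d0 t0 Y Yr tE hlt.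
have := qval_le q Y0 (Y - Y0); rewrite [Y0 + _]addrC subrK Yr.
have G0 := frobenius_ge0 (qgrad q Y0); have a0 := opnorm2_ge0 (qA q).
move: (frobenius (qgrad q Y0)) (opnorm2 (qA q)) G0 a0 tE hlt => G a G0 a0 tE hlt.
have s0 := sqrtr_ge0 (a / t).
have sE : Num.sqrt (a / t) ^+ 2 * t = a.
  by rewrite sqr_sqrtr ?divfK ?gt_eqF // divr_ge0 // ltW.
have vE : (G + 2 * a * d) / t * t = G + 2 * a * d by rewrite divfK ?gt_eqF.
have v0 : 0 <= (G + 2 * a * d) / t.
  apply: divr_ge0; last exact: ltW.
  by rewrite addr_ge0 ?mulr_ge0.
move: (Num.sqrt _) ((G + 2 * a * d) / t) s0 sE v0 vE hlt => s v s0 sE v0 vE hlt.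
have ds0 : 0 <= del * s by rewrite mulr_ge0.
have dv0 : 0 <= del * v by rewrite mulr_ge0.
have ds2 : (del * s) ^+ 2 <= del * s by nra.
have k1 : ((del * s) ^+ 2 + del * v) * t < t by rewrite gtr_pMl //; lra.
have k2 : G * r <= G * (d + del) by rewrite ler_wpM2l.
have k3 : a * r ^+ 2 <= a * (d + del) ^+ 2.
  by rewrite ler_wpM2l // lerXn2r ?nnegrE ?addr_ge0.
have k4 : ((del * s) ^+ 2 + del * v) * t = a * del ^+ 2 + del * (G + 2 * a * d).
  by rewrite -vE -{1}sE; ring.
lra.
Qed.

End Multipliers.

Section Threshold.
Context {R : realType}.

(** With S = s - 2 (rho1 + rho2) d and del = (G + a d) / (eta - a), the
    hypothesis gives S > (4 rho1 + 2 rho2) del, which already makes the new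
    denominator positive. Clearing denominators in the conclusion, the terms of
    the hypothesis cancel and what remains is
    a (S - (4 rho1 + 2 rho2) del) + 2 alpha rho2 del + rho1 G >= 0. *)
Lemma multiplier_threshold (alpha a rho1 rho2 d G eta s : R) :
  0 <= alpha -> 0 <= a -> 0 <= rho1 -> 0 <= rho2 -> 0 <= d -> 0 <= G ->
  0 < s - 2 * (rho1 + rho2) * d ->
  alpha + a + (2 * rho1 * alpha * d + 2 * (2 * rho1 + rho2) * (G + a * d))
              / (s - 2 * (rho1 + rho2) * d) < eta ->
  let r := d + (G + a * d) / (eta - a) in
  0 < s - 2 * rho2 * r /\
  alpha + rho1 * ((G + 2 * (a + eta) * r) / (s - 2 * rho2 * r)) < eta.
Proof.
move=> al0 a0 r10 r20 d0 G0 S0.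
set S := s - _ in S0 *; rewrite -ltrBrDl ltr_pdivrMr // => h /=.
have g0 : 0 <= G + a * d by rewrite addr_ge0 ?mulr_ge0.
have u0 : 0 < eta - (alpha + a).
  rewrite -(pmulr_lgt0 _ S0); apply: le_lt_trans h.
  by rewrite addr_ge0 ?mulr_ge0 ?addr_ge0 ?mulr_ge0.
have e0 : 0 < eta - a by lra.
have del0 : 0 <= (G + a * d) / (eta - a) by rewrite divr_ge0 // ltW.
have delE : (G + a * d) / (eta - a) * (eta - a) = G + a * d by rewrite divfK // gt_eqF.
move: ((G + a * d) / (eta - a)) del0 delE => del del0 delE.
have SE : s = S + 2 * (rho1 + rho2) * d by rewrite /S; ring.
clearbody S.
have rd0 : 0 <= rho1 * alpha * d by rewrite !mulr_ge0.
have Sdel : (4 * rho1 + 2 * rho2) * del < S.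
  rewrite -(ltr_pM2l e0).
  have aS : 0 <= alpha * S by rewrite mulr_ge0 // ltW.
  have : (eta - a) * ((4 * rho1 + 2 * rho2) * del)
      = 2 * (2 * rho1 + rho2) * (G + a * d) by rewrite -delE; ring.
  lra.
have r1del : 0 <= rho1 * del by rewrite mulr_ge0.
have r1d : 0 <= rho1 * d by rewrite mulr_ge0.
have den0 : 0 < s - 2 * rho2 * (d + del) by rewrite SE; lra.
split=> //; rewrite -ltrBrDl mulrA ltr_pdivrMr //.
have k1 : 0 <= a * (S - (4 * rho1 + 2 * rho2) * del) by rewrite mulr_ge0 //; lra.
have k2 : 0 <= rho2 * del * alpha by rewrite !mulr_ge0.
have k3 : 0 <= rho1 * G by rewrite mulr_ge0.
have k4 : rho1 * (del * (eta - a)) = rho1 * (G + a * d) by rewrite delE.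
have k5 : rho2 * (del * (eta - a)) = rho2 * (G + a * d) by rewrite delE.
rewrite SE; lra.
Qed.

End Threshold.

(** * Exactness of the penalized relaxation *)

Theorem theorem2 (R : realType) (n m : nat) (E I : finType)
  (P : qcqp R n m E I) (Y0 : 'M[R]_(n, m)) (eta : R)
  (hF : feasible P !=set0)
  (heta0 : 0 < eta)
  (hglicq : glicq P Y0)
  (hs : ((2 * (rho1 P + rho2 P) * dist P Y0)%:E < sfun P Y0)%E)
  (heta1 :
    ((opnorm1 (qA (obj P)) + opnorm2 (qA (obj P)))%:E
     + (2 * rho1 P * opnorm1 (qA (obj P)) * dist P Y0
        + 2 * (2 * rho1 P + rho2 P)
            * (frobenius (qgrad (obj P) Y0)
               + opnorm2 (qA (obj P)) * dist P Y0))%:E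
       / (sfun P Y0 - (2 * (rho1 P + rho2 P) * dist P Y0)%:E)
     < eta%:E)%E)
  (heta2 : forall k : I, inr k \notin quasi_binding P Y0 ->
    opnorm2 (qA (obj P))
    + (frobenius (qgrad (obj P) Y0) + opnorm2 (qA (obj P)) * dist P Y0)
      * (Num.sqrt (opnorm2 (qA (con P (inr k)))
                   / `|qtilde P (con P (inr k)) Y0|)
         + (frobenius (qgrad (con P (inr k)) Y0)
            + 2 * opnorm2 (qA (con P (inr k))) * dist P Y0)
           / `|qtilde P (con P (inr k)) Y0|)
    < eta) :
  exists (Y : 'M[R]_(n, m)) (X : 'M[R]_n),
    [/\ penalized_optimal P Y0 eta Y X,
        forall Y' X', penalized_optimal P Y0 eta Y' X' -> Y' = Y /\ X' = X,
        X = Y *m Y^T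
      & qval (obj P) Y <= qtilde P (obj P) Y0].
Proof.
have [Yd fYd Ydd] := dist_attained Y0 hF.
set d := dist P Y0 in hs heta1 heta2 Ydd.
set a := opnorm2 (qA (obj P)) in heta1 heta2.
set alpha := opnorm1 (qA (obj P)) in heta1.
set G := frobenius (qgrad (obj P) Y0) in heta1 heta2.
set B := quasi_binding P Y0.
have d0 : 0 <= d by rewrite -Ydd frobenius_ge0.
have a0 : 0 <= a := opnorm2_ge0 _.
have alpha0 : 0 <= alpha := opnorm1_ge0 _.
have G0 : 0 <= G := frobenius_ge0 _.
have r10 : 0 <= rho1 P by apply: pencil_norm_ge0 => M; exact: opnorm1_ge0.
have r20 : 0 <= rho2 P by apply: pencil_norm_ge0 => M; exact: opnorm2_ge0.
pose r := d + (G + a * d) / (eta - a).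
(* Both cases of the singularity function yield one bound T on the multipliers
   of stationary points near Y0, small enough for diagonal dominance. If no
   constraint is quasi-binding these multipliers vanish; the case of too many
   quasi-binding constraints contradicts hs, a strict upper bound of 0 being
   impossible for a nonnegative number. *)
have [asmall [T Tsmall Tbound]] : alpha + a < eta /\
    exists2 T, alpha + rho1 P * T < eta &
      forall Y tau, frobenius (Y - Y0) <= r -> (forall k, k \notin B -> tau k = 0) ->
        qgrad (penalized_quad P Y0 eta) Y + \sum_k tau k *: qgrad (con P k) Y = 0 ->
        l2norm tau <= T.
  move: hs heta1; rewrite /sfun -/B; case: ifPn => [/eqP B0 _ | _].
    rewrite addye // /inve mule0 adde0 lte_fin => h1; split=> //.
    exists 0; first by rewrite mulr0 addr0; lra.
    move=> Y tau _ supp _; rewrite /l2norm big1 ?sqrtr0 // => k _.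
    by rewrite supp ?expr0n // B0 inE.
  case: ifP => _; last first.
    by rewrite lte_fin ltNge mulr_ge0 ?mulr_ge0 ?addr_ge0.
  rewrite lte_fin -subr_gt0 => S0; rewrite -EFinB inver gt_eqF // -EFinM -EFinD lte_fin => h1.
  have num0 : 0 <= 2 * rho1 P * alpha * d + 2 * (2 * rho1 P + rho2 P) * (G + a * d).
    by rewrite addr_ge0 ?mulr_ge0 ?addr_ge0 ?mulr_ge0.
  split.
    by apply: le_lt_trans h1; rewrite lerDl divr_ge0 // ltW.
  have [den0 thr] := multiplier_threshold alpha0 a0 r10 r20 d0 G0 S0 h1.
  exists ((G + 2 * (a + eta) * r) / (sigma_min (jacobian P B Y0) - 2 * rho2 P * r)) => //.
  move=> Y tau Yr supp stat; rewrite ler_pdivlMr // mulrC.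
  exact: multiplier_bound (ltW heta0) Yr supp stat.
have aeta : a < eta by lra.
have e0 : 0 < eta - a by rewrite subr_gt0.
have g0 : 0 <= G + a * d by rewrite addr_ge0 ?mulr_ge0.
have del0 : 0 <= (G + a * d) / (eta - a) by rewrite divr_ge0 // ltW.
have [Y [tau [kktY tauT]]] : exists Y tau, kkt P Y0 eta Y tau /\ l2norm tau <= T.
  apply: (@kkt_limit _ _ _ _ _ P Y0 eta r T) => w w0.
  have [Y [Yr stat]] := penalty_point Y0 aeta hF w0.
  exists Y, (fun k => 2 * w * violation P k Y); split=> //.
  apply: (Tbound _ _ Yr _ stat) => -[k|k]; rewrite inE // -ltNge => qt0.
  have t0 : 0 < `|qtilde P (con P (inr k)) Y0| by rewrite normr_gt0 lt_eqF.
  suff h : qval (con P (inr k)) Y < 0.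
    by rewrite /= (max_idPr (ltW h)) mulr0.
  apply: (strictly_inactive del0 Yr (frobenius_ge0 _) d0 t0 erefl).
    by rewrite ltr0_norm // opprK.
  rewrite mulrAC ltr_pdivrMr // mul1r ltrBrDl; apply: heta2.
  by rewrite inE -ltNge.
have [opt uniq] := kkt_exact kktY (le_lt_trans (lerD (lexx _) (ler_wpM2l r10 tauT)) Tsmall).
exists Y, (Y *m Y^T); split=> //.
have [fY _ _ _] := kktY; have [_ /(_ _ _ (parabolic_rank fYd))] := opt.
rewrite -!penalized_quad_lift !qlift_rank !penalized_quad_val Ydd => hle.
have dY : d <= frobenius (Y - Y0).
  by apply: ge_inf; [exists 0 => _ [Z _ <-]; exact: frobenius_ge0|exists Y].
have := qval_le (obj P) Y0 (Yd - Y0); rewrite [Y0 + _]addrC subrK Ydd.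
apply: le_trans.
have : eta * d ^+ 2 <= eta * frobenius (Y - Y0) ^+ 2.
  by rewrite ler_wpM2l ?(ltW heta0) // lerXn2r ?nnegrE ?frobenius_ge0.
lra.
Qed.
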